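(* The loops $$p_{\alpha,W}(\lambda)=\frac{\lambda-\alpha}{\lambda-\bar\alpha}\,\pi_W+\pi_{W^\perp},$$ where $\alpha$ ranges over $\mathbb C\setminus\mathbb R$ and $W$ ranges over the Lagrangian subspaces of $(\mathbb C^{2n},\omega)$, generate the group $\mathcal L_-^\tau(\mathrm{CSp}(n,\mathbb C),\mathbb C^{2n})$.
   Context: Let $\omega(v,w)={}^tvJw$ on $\mathbb C^{2n}$, with $J=\begin{pmatrix}0&I_n\\-I_n&0\end{pmatrix}$. The conformal symplectic group is $\mathrm{CSp}(n,\mathbb C)=\{A\in \mathrm{GL}(2n,\mathbb C): \omega(Av,Aw)=c\,\omega(v,w)\ \forall v,w,\text{ for some }c\in\mathbb C\}$. A loop in a complex Lie group $G$ is a holomorphic map $g:U\to G$ with $U\subset\mathbb{CP}^1$ open and dense; loops agreeing on an open dense set are identified, and loops are multiplied pointwise. Let $\tau(g)=(\bar g^{\,t})^{-1}$. The group $\mathcal L_-^\tau(\mathrm{CSp}(n,\mathbb C),\mathbb C^{2n})$ consists of the loops $g$ in $\mathrm{CSp}(n,\mathbb C)$ that are rational (i.e. $g:\mathbb{CP}^1\to \mathrm{End}(\mathbb C^{2n})$ is meromorphic), negative ($g$ is holomorphic at $\infty$ with $g(\infty)=\mathrm{Id}$) and satisfy the reality condition $\tau(g(\bar\lambda))=g(\lambda)$. A Lagrangian subspace is an $n$-dimensional complex subspace of $\mathbb C^{2n}$ on which $\omega$ vanishes. $\perp$ is the orthogonal complement for the standard hermitian inner product, and $\pi_W,\pi_{W^\perp}$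 are the orthogonal projections for $\mathbb C^{2n}=W\oplus W^\perp$. The loops $p_{\alpha,W}$ belong to $\mathcal L_-^\tau(\mathrm{CSp}(n,\mathbb C),\mathbb C^{2n})$ and are called simple elements. *)

(* Defs.v *)
From mathcomp Require Import all_boot all_order all_algebra.
From mathcomp Require Import sesquilinear spectral.
From mathcomp Require Import all_classical all_reals all_analysis.
From mathcomp Require Import complex.

Set Implicit Arguments.
Unset Strict Implicit.
Unset Printing Implicit Defensive.

Import Order.TTheory GRing.Theory Num.Theory.
Import numFieldNormedType.Exports.

Local Open Scope classical_set_scope.
Local Open Scope ring_scope.

(* Naming the structure (rather than using the bare type R[i]) lets the norm
   topology of a numClosedFieldType be inferred on it. *)
Definition Cplx (R : realType) : numClosedFieldType := R[i]%C.

(* [Some z] is the finite point z, [None] is the point at infinity. *)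
Notation CP1 R := (one_point_compactification (Cplx R)).

Section RiemannSphere.
Variable R : realType.
Local Notation C := (Cplx R).
Local Notation CP1 := (CP1 R).

(* Holomorphic coordinate centred at p: z |-> a + z at a finite point a, and
   z |-> 1/z at infinity. *)
Definition chart (p : CP1) (z : C) : CP1 :=
  match p with
  | Some a => Some (a + z)
  | None => if z == 0 then None else Some z^-1
  end.

Definition holomorphic_at (f : CP1 -> C) (p : CP1) : Prop :=
  \forall z \near (0 : C), derivable (f \o chart p : C -> C) z 1.

(* The value of f at p itself is irrelevant here. *)
Definition meromorphic_at (f : CP1 -> C) (p : CP1) : Prop :=
  exists (k : nat) (h : C -> C),
    (\forall z \near (0 : C), derivable h z 1) /\
    (\forall z \near (0 : C)^', f (chart p z) = z ^- k * h z).

Definition conjCP1 (p : CP1) : CP1 :=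
  if p is Some z then Some z^* else None.

End RiemannSphere.

Section Loops.
Variables (R : realType) (m : nat).
Local Notation C := (Cplx R).
Local Notation CP1 := (CP1 R).
Local Notation maps := (CP1 -> 'M[C]_m).

(* A loop g : U -> G is represented by any extension of g to the whole sphere.
   The values outside U are arbitrary; they are disregarded by [loop_eq], and
   every predicate on loops below is invariant under [loop_eq]. *)
Definition is_loop (G : set 'M[C]_m) (g : maps) : Prop :=
  exists U : set CP1, [/\ open U, dense U,
    forall p, U p -> forall i j, holomorphic_at (fun q => g q i j) p &
    forall p, U p -> G (g p)].

Definition loop_eq (g h : maps) : Prop :=
  exists U : set CP1, [/\ open U, dense U & forall p, U p -> g p = h p].

Definition loop_one : maps := fun=> 1%:M.
Definition loop_mul (g h : maps) : maps := fun p => g p *m h p.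
Definition loop_inv (g : maps) : maps := fun p => invmx (g p).

Definition rational_loop (g : maps) : Prop :=
  exists h : maps, loop_eq g h /\
    forall p i j, meromorphic_at (fun q => h q i j) p.

Definition negative_loop (g : maps) : Prop :=
  exists h : maps, [/\ loop_eq g h,
    forall i j, holomorphic_at (fun q => h q i j) None &
    h None = 1%:M].

Definition tau (A : 'M[C]_m) : 'M[C]_m := invmx (map_mx Num.conj A)^T.

Definition reality_condition (g : maps) : Prop :=
  loop_eq (fun p => tau (g (conjCP1 p))) g.

Inductive generated (S : set maps) : set maps :=
| generated_in g : S g -> generated S g
| generated_one : generated S loop_one
| generated_mul g h :
    generated S g -> generated S h -> generated S (loop_mul g h)
| generated_inv g : generated S g -> generated S (loop_inv g)
| generated_eq g h : loop_eq g h -> generated S g -> generated S h.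

End Loops.

Section ConformalSymplectic.
Variables (R : realType) (n : nat).
Local Notation C := (Cplx R).

Definition J : 'M[C]_(n + n) := block_mx 0 1%:M (- 1%:M) 0.

Definition omega (v w : 'cV[C]_(n + n)) : C := (v^T *m J *m w) 0 0.

Definition CSp : set 'M[C]_(n + n) :=
  [set A | A \in unitmx /\
    exists c : C, forall v w, omega (A *m v) (A *m w) = c * omega v w].

Definition Lminus_tau : set (CP1 R -> 'M[C]_(n + n)) :=
  [set g | [/\ is_loop CSp g, rational_loop g, negative_loop g &
    reality_condition g]].

(* As usual in MathComp, a subspace is given as the row space of a matrix W; a
   column vector v belongs to it when (v^T <= W)%MS. *)
Definition lagrangian (W : 'M[C]_(n + n)) : Prop :=
  \rank W = n /\
  forall v w, (v^T <= W)%MS -> (w^T <= W)%MS -> omega v w = 0.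

(* Orthogonal complement for the standard hermitian product; this is the local
   notation of spectral.v. *)
Local Notation "W ^!" :=
  (orthomx Num.conj (mx_of_hermitian (hermitian1mx _)) W) : matrix_set_scope.

(* [proj_ortho W] acts on row vectors by right multiplication, so its transpose
   is the matrix of the projection of column vectors. *)
Definition orthoproj (W : 'M[C]_(n + n)) : 'M[C]_(n + n) := (proj_ortho W)^T.

(* The value at infinity is the limit of the formula. *)
Definition simple_element (a : C) (W : 'M[C]_(n + n)) :
    CP1 R -> 'M[C]_(n + n) :=
  fun p => if p is Some z
           then ((z - a) / (z - a^*)) *: orthoproj W + orthoproj (W^!)%MS
           else 1%:M.

Definition simple_elements : set (CP1 R -> 'M[C]_(n + n)) :=
  [set g | exists (a : C) (W : 'M[C]_(n + n)),
    [/\ a \isn't Num.real, lagrangian W & g = simple_element a W]].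

End ConformalSymplectic.

Arguments Lminus_tau : clear implicits.
Arguments simple_elements : clear implicits.

(* Main.v *)
Require Import Defs.
From mathcomp Require Import all_boot all_order all_algebra.
From mathcomp Require Import ring lra zify.
From mathcomp Require Import sesquilinear spectral.
From mathcomp Require Import all_classical all_reals all_analysis.
From mathcomp Require Import complex.

(** Why the simple elements generate the group.

  Algebra. A rational loop is a quotient P / q of a matrix of polynomials by a
  polynomial. For such a quotient the four conditions on a loop become
  polynomial identities ([presents]): P^T J P = r J for some r <> 0 (conformal
  symplectic), P^* P = q q^* (reality), and P - q Id has smaller degree than q
  (value Id at infinity). Here p^* has the conjugate coefficients, so that
  p^*(z) is the conjugate of p at the conjugate of z. These identities give
  r P^* = - q q^* J P^T J. Let b be a root of q and b' its conjugate. If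
  r(b') <> 0, this forces P(b) = 0, and if b is real, P(b) = 0 because P^* P is
  positive on the real line; in both cases X - b cancels in P / q and the degree
  of q drops. Otherwise P(b')^T J P(b') = 0, that is, the image of P(b') is
  isotropic. An isotropic subspace lies in a Lagrangian one, and the orthogonal
  complement W of a Lagrangian subspace is Lagrangian ([lagrangian_kill]): so
  one finds a Lagrangian W with pi_W P(b') = 0. Dividing the loop on the left by
  p_{b',W} then creates no new pole ([presents_quotient]); the denominator q
  stays and r exchanges a zero at b' for one at b. After finitely many divisions
  r(b') <> 0. When q is constant, the loop is Id. This induction is
  [presents_ind]. Conversely, presentations are stable under products and
  inverses and exist for the simple elements.

  Analysis. What remains is that a loop whose entries are meromorphic on the
  whole sphere has such a presentation ([meromorphic_rational]). The sphere
  being compact, one nonzero polynomial clears all the finite poles of an entry;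
  the product is entire and grows polynomially because infinity is at most a
  pole, so it is a polynomial ([liouville]). Liouville's theorem comes from
  Cauchy's estimate |f'(z)| <= max |f| / r over the circle of radius r around z,
  and that from Goursat's theorem for rectangles with sides parallel to the axes
  ([goursat]) applied to the function f(z + e^w) e^(-w) of w: it has period
  2 i pi, so its integral over a vertical period does not depend on the real
  part of w, i.e. on the radius, and tends to 2 pi f'(z) as the radius tends to
  0 ([cauchy_deriv]).

  Two loops that agree on an open dense set are identified; polynomial
  identities pass from an open dense set to the whole plane, which makes the two
  descriptions of a loop equivalent. *)

Set Implicit Arguments.
Unset Strict Implicit.
Unset Printing Implicit Defensive.

Import Order.TTheory GRing.Theory Num.Theory.
Import numFieldNormedType.Exports.
Import Normc.

Local Open Scope classical_set_scope.
Local Open Scope ring_scope.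

Local Notation "W ^!" :=
  (orthomx Num.conj (mx_of_hermitian (hermitian1mx _)) W) : matrix_set_scope.

(** * Complex numbers with a real-valued modulus *)

(** The derivative as a first-order expansion, the form suited to explicit
  estimates; there is no division by the increment. *)
Lemma is_deriveP (K : numFieldType) (f : K -> K) (z l : K) :
  is_derive z (1 : K) f l <->
  forall e, 0 < e -> exists2 d, 0 < d &
    forall h, `|h| < d -> `|f (z + h) - f z - h * l| <= e * `|h|.
Proof.
split=> [[df <-] e e0|H].
  have : (fun h : K => h^-1 *: ((f \o shift z) (h *: (1:K)) - f z)) @ 0^' --> 'D_1 f z.
    exact: df.
  move=> /cvgrPdist_le /(_ e e0); rewrite /dnbhs /= => -[d /= d0 Hd].
  exists d => // h hd; have [->|h0] := eqVneq h 0.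
    by rewrite addr0 subrr mul0r subr0 normr0 mulr0.
  have := Hd h; rewrite /ball_ /= sub0r normrN => /(_ hd h0).
  rewrite /= /GRing.scale /= mulr1 distrC [h + z]addrC => Hh.
  have -> : f (z + h) - f z - h * 'D_1 f z =
    (h^-1 * (f (z + h) - f z) - 'D_1 f z) * h by field.
  by rewrite normrM ler_wpM2r.
have cv : (fun h : K => h^-1 *: ((f \o shift z) (h *: (1:K)) - f z)) @ 0^' --> l.
  apply/cvgrPdist_le => e e0; have [d d0 Hd] := H e e0.
  exists d => //= h; rewrite /ball_ /= sub0r normrN => hd h0.
  rewrite /GRing.scale /= mulr1 distrC [h + z]addrC.
  have := Hd h hd.
  have -> : f (z + h) - f z - h * l =
    (h^-1 * (f (z + h) - f z) - l) * h by field.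
  by rewrite normrM ler_pM2r // normr_gt0.
split; last exact: cvg_lim cv.
by apply/cvg_ex; exists l.
Qed.

Section RealModulus.
Variable R : realType.
Local Notation C := (Cplx R).

(** The norm of a [numClosedFieldType] takes its values in that same field, where
  order reasoning is awkward; [cabs] is the modulus as a real number. *)
Definition cabs (z : C) : R := normc z.
Definition cre (z : C) : R := complex.Re z.
Definition cim (z : C) : R := complex.Im z.
Definition rc (x : R) : C := (x%:C)%C.
Definition ci : C := ('i)%C.

Lemma normE (z : C) : `|z| = rc (cabs z). Proof. by []. Qed.
Lemma rc_le x y : (rc x <= rc y) = (x <= y). Proof. exact: lecR. Qed.
Lemma rc_lt x y : (rc x < rc y) = (x < y). Proof. exact: ltcR. Qed.
Lemma rcD x y : rc (x + y) = rc x + rc y. Proof. exact: rmorphD. Qed.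
Lemma rcM x y : rc (x * y) = rc x * rc y. Proof. exact: rmorphM. Qed.
Lemma rcB x y : rc (x - y) = rc x - rc y. Proof. exact: rmorphB. Qed.
Lemma rc0 : rc 0 = 0. Proof. by []. Qed.
Lemma rc1 : rc 1 = 1. Proof. by []. Qed.
Lemma ci2 : ci * ci = -1. Proof. by rewrite -expr2; apply: sqr_i. Qed.
Lemma cre_cim (z : C) : z = rc (cre z) + ci * rc (cim z). Proof. exact: complexE. Qed.
Lemma creD z w : cre (z + w) = cre z + cre w. Proof. by case: z w => ? ? []. Qed.
Lemma cimD z w : cim (z + w) = cim z + cim w. Proof. by case: z w => ? ? []. Qed.
Lemma creN z : cre (- z) = - cre z. Proof. by case: z. Qed.
Lemma cimN z : cim (- z) = - cim z. Proof. by case: z. Qed.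
Lemma creM z w : cre (z * w) = cre z * cre w - cim z * cim w.
Proof. by case: z w => ? ? []. Qed.
Lemma cimM z w : cim (z * w) = cre z * cim w + cim z * cre w.
Proof. by case: z w => ? ? []. Qed.
Lemma cre_rc x y : cre (rc x + ci * rc y) = x.
Proof. by rewrite creD creM /cre /cim /= mul0r mul1r subr0 addr0. Qed.
Lemma cim_rc x y : cim (rc x + ci * rc y) = y.
Proof. by rewrite cimD cimM /cre /cim /= mul0r mul1r !add0r. Qed.

Lemma cabs0 : cabs 0 = 0. Proof. exact: normc0. Qed.
Lemma cabs1 : cabs 1 = 1. Proof. exact: normc1. Qed.
Lemma cabsM z w : cabs (z * w) = cabs z * cabs w. Proof. exact: normcM. Qed.
Lemma cabsN z : cabs (- z) = cabs z. Proof. exact: normcN. Qed.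
Lemma cabsV z : cabs (z^-1) = (cabs z)^-1. Proof. exact: normcV. Qed.
Lemma cabsD z w : cabs (z + w) <= cabs z + cabs w. Proof. exact: le_normcD. Qed.
Lemma cabs_ge0 z : 0 <= cabs z.
Proof. by rewrite -rc_le -normE normr_ge0. Qed.
Lemma cabs_eq0 z : (cabs z == 0) = (z == 0).
Proof. by rewrite -[RHS]normr_eq0 normE -[0 in RHS]rc0 (inj_eq (@complexI R)). Qed.
Lemma cabs_gt0 z : (0 < cabs z) = (z != 0).
Proof. by rewrite lt_neqAle cabs_ge0 andbT eq_sym cabs_eq0. Qed.
Lemma cabsBC z w : cabs (z - w) = cabs (w - z).
Proof. by rewrite -cabsN opprB. Qed.
Lemma cabsB z w : cabs (z - w) <= cabs z + cabs w.
Proof. by rewrite -(cabsN w) cabsD. Qed.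
Lemma cabs_rc x : cabs (rc x) = `|x|.
Proof. by apply: (@complexI R); have := normE (rc x); rewrite normc_def /= expr0n /= addr0 sqrtr_sqr. Qed.
Lemma cabs_ci : cabs ci = 1.
Proof. by rewrite /cabs /= expr0n add0r expr1n sqrtr1. Qed.
Lemma cre_le z : `|cre z| <= cabs z.
Proof. by rewrite -rc_le; exact: normc_ge_Re. Qed.
Lemma cim_le z : `|cim z| <= cabs z.
Proof.
have -> : cim z = - cre (ci * z) by rewrite creM /= mul0r mul1r sub0r opprK.
by rewrite normrN (le_trans (cre_le _)) // cabsM cabs_ci mul1r.
Qed.
Lemma cabs_conj z : cabs z^* = cabs z.
Proof. by apply: (@complexI R); exact: (norm_conjC z). Qed.
Lemma cabsX z n : cabs (z ^+ n) = cabs z ^+ n.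
Proof. by elim: n => [|n IH]; rewrite ?cabs1 // !exprS cabsM IH. Qed.

Lemma nbhsCP (z : C) (A : set C) :
  nbhs z A <-> exists2 d : R, 0 < d & forall w, cabs (w - z) < d -> A w.
Proof.
split=> [/nbhs_ballP[e /= e0 H]|[d d0 H]].
  have eE : e = rc (cabs e) by rewrite -normE gtr0_norm.
  exists (cabs e); first by rewrite -rc_lt -eE.
  move=> w wz; apply: H; rewrite -ball_normE /ball_ /= normE eE rc_lt.
  by rewrite cabsBC.
apply/nbhs_ballP; exists (rc d); first by rewrite /= -[0]rc0 rc_lt.
move=> w; rewrite -ball_normE /ball_ /= normE rc_lt cabsBC; exact: H.
Qed.

Lemma cderivP (f : C -> C) (z l : C) :
  is_derive z (1 : C) f l <->
  forall e : R, 0 < e -> exists2 d : R, 0 < d &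
    forall h, cabs h < d -> cabs (f (z + h) - f z - h * l) <= e * cabs h.
Proof.
rewrite is_deriveP; split=> H e e0.
  have [|d d0 Hd] := H (rc e); first by rewrite -[0]rc0 rc_lt.
  have dE : d = rc (cabs d) by rewrite -normE gtr0_norm.
  exists (cabs d); first by rewrite -rc_lt -dE.
  move=> h hd; have := Hd h; rewrite !normE dE rc_lt -rcM rc_le; exact.
have eE : e = rc (cabs e) by rewrite -normE gtr0_norm.
have [|d d0 Hd] := H (cabs e); first by rewrite -rc_lt -eE.
exists (rc d); first by rewrite -[0]rc0 rc_lt.
by move=> h; rewrite !normE rc_lt eE -rcM rc_le; exact: Hd.
Qed.

Definition ccont (f : C -> C) (z : C) := forall e : R, 0 < e -> exists2 d : R, 0 < d &
    forall h, cabs h < d -> cabs (f (z + h) - f z) <= e.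

Lemma cderiv_cont f z l : is_derive z (1 : C) f l -> ccont f z.
Proof.
move=> /cderivP H e e0; have [d d0 Hd] := H 1 ltr01.
have p0 : 0 < 1 + cabs l by have := cabs_ge0 l; lra.
exists (Num.min d (e / (1 + cabs l))).
  by rewrite lt_min d0 divr_gt0.
move=> h; rewrite lt_min => /andP[/Hd hd]; rewrite ltr_pdivlMr // => he.
rewrite -(subrK (h * l) (_ - _)) (le_trans (cabsD _ _)) // cabsM.
by apply: le_trans (ltW he); rewrite mulrDr mulr1 lerD // -[leRHS]mul1r.
Qed.

End RealModulus.

(** * Primitives of continuous real functions *)

Section RealPrimitive.
Variable R : realType.

(** The fundamental theorem of calculus for the integral from -1, which only
  gives a primitive to the right of -1. *)
Lemma ftc_right (f : R -> R) : continuous f ->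
  exists F : R -> R, forall x : R, -1 < x -> is_derive x 1 F (f x).
Proof.
move=> cf; exists (fun x => (\int[lebesgue_measure]_(t in [set` `[-1, x]]) (f t))%R) => x x1.
have intf : lebesgue_measure.-integrable `[-1, x + 1] (EFin \o f).
  apply: continuous_compact_integrable; first exact: segment_compact.
  exact: continuous_subspaceT.
have xx1 : x < x + 1 by rewrite ltrDl.
have [d1 d2] := continuous_FTC1_closed xx1 intf x1 (cf x).
by apply: DeriveDef; [exact: d1|rewrite -derive1E; exact: d2].
Qed.

(** A primitive on the whole line: a primitive on ]-1, +oo[ and the reflection of
  one of the reflected function, valid on ]-oo, 1[, differ by a constant on
  ]-1, 1[ and can be glued at 0. *)
Lemma ftc_real (f : R -> R) : continuous f ->
  exists F : R -> R, forall x : R, is_derive x 1 F (f x).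
Proof.
move=> cf; have [F1 dF1] := ftc_right cf.
have cfN : continuous (fun x => f (- x)).
  by move=> x; apply: continuous_comp; [exact: opp_continuous|exact: cf].
have [G dG] := ftc_right cfN.
pose F2 x := - G (- x).
have dF2 (x : R) : x < 1 -> is_derive x 1 F2 (f x).
  move=> x1; have nx1 : -1 < - x by rewrite ltrN2.
  have := dG _ nx1; rewrite /= opprK !is_deriveP => H e e0.
  have [d d0 Hd] := H e e0; exists d => // h hd.
  have := Hd (- h); rewrite normrN /F2 => /(_ hd).
  move=> Hh; rewrite opprD -normrN.
  by have -> : - (- G (- x - h) - - G (- x) - h * f x) = G (- x - h) - G (- x) - (- h) * f x by ring.
have eqF (x : R) : -1 < x < 1 -> F1 x - F1 0 = F2 x - F2 0.
  move=> /andP[x1 x2].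
  have dD (y : R) : -1 < y < 1 -> is_derive y 1 (F1 - F2) (0 : R).
    move=> /andP[y1 y2]; have := dF1 _ y1; have := dF2 _ y2 => ? ?.
    by apply: is_derive_eq; rewrite subrr.
  have cst (a b : R) : -1 < a -> b < 1 -> a <= b -> (F1 - F2) b = (F1 - F2) a.
    move=> a1 b1 ab.
    have [||c _] := @MVT_segment _ (F1 - F2) (fun=> 0) _ _ ab.
    - move=> y /itvP yab; apply: dD.
      by rewrite (lt_le_trans a1) ?(le_lt_trans _ b1) ?yab.
    - apply: derivable_within_continuous => y /itvP yab.
      have ? : is_derive y 1 (F1 - F2) (0 : R).
        by apply: dD; rewrite (lt_le_trans a1) ?(le_lt_trans _ b1) ?yab.
      exact: ex_derive.
    by rewrite mul0r => /eqP; rewrite subr_eq0 => /eqP.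
  have H : F1 x - F2 x = F1 0 - F2 0.
    change ((F1 - F2) x = (F1 - F2) 0).
    by case: (leP 0 x) => x0; [apply: cst|apply/esym/cst] => //; rewrite ?ltW //; lra.
  lra.
(* Both branches are valid on ]-1, 1[ by [eqF]: an increment less than 1 may
   leave the half-line of x. *)
exists (fun x => if 0 <= x then F1 x - F1 0 else F2 x - F2 0) => x.
rewrite is_deriveP => e e0.
have [x0|x0] := leP 0 x.
  have /is_deriveP/(_ e e0)[d d0 Hd] : is_derive x 1 F1 (f x) by apply: dF1; lra.
  exists (Num.min d 1); first by rewrite lt_min d0 ltr01.
  move=> h; rewrite lt_min => /andP[/Hd hd h1].
  have -> : (if 0 <= x + h then F1 (x + h) - F1 0 else F2 (x + h) - F2 0) = F1 (x + h) - F1 0.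
    case: leP => // xh; rewrite eqF //; move: h1; rewrite ltr_norml => /andP[? ?].
    by apply/andP; split; lra.
  by have -> : F1 (x + h) - F1 0 - (F1 x - F1 0) - h * f x = F1 (x + h) - F1 x - h * f x by ring.
have /is_deriveP/(_ e e0)[d d0 Hd] : is_derive x 1 F2 (f x) by apply: dF2; lra.
exists (Num.min d 1); first by rewrite lt_min d0 ltr01.
move=> h; rewrite lt_min => /andP[/Hd hd h1].
have -> : (if 0 <= x + h then F1 (x + h) - F1 0 else F2 (x + h) - F2 0) = F2 (x + h) - F2 0.
  case: leP => // xh; rewrite eqF //; move: h1; rewrite ltr_norml => /andP[? ?].
  by apply/andP; split; lra.
by have -> : F2 (x + h) - F2 0 - (F2 x - F2 0) - h * f x = F2 (x + h) - F2 x - h * f x by ring.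
Qed.

End RealPrimitive.

(** * Integration of continuous curves in the complex plane *)

Section ComplexIntegral.
Variable R : realType.
Local Notation C := (Cplx R).
Implicit Types u v U V : R -> C.

Definition rcont u t := forall e : R, 0 < e -> exists2 d : R, 0 < d &
  forall h, `|h| < d -> cabs (u (t + h) - u t) <= e.
Definition rderiv U t l := forall e : R, 0 < e -> exists2 d : R, 0 < d &
  forall h, `|h| < d -> cabs (U (t + h) - U t - rc h * l) <= e * `|h|.

(** Real functions are extracted from a complex-valued one by projecting on a
  direction c; the mean value inequality below chooses c. *)
Lemma rderiv_re (c : C) U t l : rderiv U t l ->
  is_derive t 1 (fun s => cre (c * U s)) (cre (c * l)).
Proof.
move=> H; apply/is_deriveP => e e0.
have p0 : 0 < 1 + cabs c by have := cabs_ge0 c; lra.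
have [|d d0 Hd] := H (e / (1 + cabs c)); first by rewrite divr_gt0.
exists d => // h /Hd hd.
have -> : cre (c * U (t + h)) - cre (c * U t) - h * cre (c * l) =
   cre (c * (U (t + h) - U t - rc h * l)).
  by rewrite !mulrBr !(creD, creN) mulrCA [cre (rc h * _)]creM /= mul0r subr0.
rewrite (le_trans (cre_le _)) // cabsM.
rewrite (le_trans (ler_wpM2l (cabs_ge0 _) hd)) // mulrA ler_wpM2r //.
rewrite mulrCA ger_pMr // ler_pdivrMr // mul1r; have := cabs_ge0 c; lra.
Qed.

(** The mean value inequality for a complex-valued function: the real mean value
  theorem is applied to the component of U in the direction of U b - U a. *)
Lemma rderiv_bound U u a b M : a <= b -> (forall t, rderiv U t (u t)) ->
  (forall t, a <= t <= b -> cabs (u t) <= M) -> cabs (U b - U a) <= M * (b - a).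
Proof.
move=> ab dU uM; set c := U b - U a.
(* The component of U b - U a in the direction c is |c|^2. *)
have dV (t : R) : is_derive t 1 (fun s => cre (c^* * U s)) (cre (c^* * u t)).
  exact: rderiv_re.
have [|t tab] := @MVT_segment _ (fun s => cre (c^* * U s)) (fun t => cre (c^* * u t)) _ _ ab.
- by apply: derivable_within_continuous => t _; have := dV t => ?; exact: ex_derive.
have [c0|c0] := eqVneq c 0.
  rewrite c0 cabs0 => _; rewrite mulr_ge0 ?subr_ge0 //.
  by rewrite (le_trans (cabs_ge0 (u a))) // uM // lexx.
have -> : cre (c^* * U b) - cre (c^* * U a) = cabs c * cabs c.
  rewrite -creN -creD -mulrBr -/c mulrC -normCK normE -rmorphXn /=.
  by rewrite expr2.
move=> H.
have cp : 0 < cabs c by rewrite cabs_gt0.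
rewrite -(ler_pM2l cp) H mulrA ler_wpM2r ?subr_ge0 //.
rewrite (le_trans (ler_norm _)) // (le_trans (cre_le _)) // cabsM cabs_conj.
by rewrite ler_wpM2l ?cabs_ge0 // uM //; move: tab; rewrite in_itv.
Qed.

Lemma rcont_prim u : (forall t, rcont u t) -> exists U, forall t, rderiv U t (u t).
Proof.
move=> cu.
have cv (p : C -> R) : (forall z w, p (z - w) = p z - p w) -> (forall z, `|p z| <= cabs z) ->
    exists F : R -> R, forall x : R, is_derive x 1 F (p (u x)).
  move=> pB ple; apply: (@ftc_real _ (p \o u)) => t; apply/cvgrPdist_le => e e0.
  have [d d0 Hd] := cu t e e0.
  apply/nbhs_ballP; exists d => // s ts; have sd : `|s - t| < d by rewrite distrC; exact: ts.
  have := Hd (s - t) sd; have -> : t + (s - t) = s by ring.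
  by move=> H; rewrite distrC /= -pB (le_trans (ple _)).
have [F1 dF1] := cv (@cre R) (fun z w => etrans (creD _ _) (congr1 _ (creN _))) (@cre_le R).
have [F2 dF2] := cv (@cim R) (fun z w => etrans (cimD _ _) (congr1 _ (cimN _))) (@cim_le R).
exists (fun t => rc (F1 t) + ci R * rc (F2 t)) => t e e0.
have e20 : 0 < e / 2 by lra.
have [d1 d10 H1] := (is_deriveP _ _ _).1 (dF1 t) _ e20.
have [d2 d20 H2] := (is_deriveP _ _ _).1 (dF2 t) _ e20.
exists (Num.min d1 d2); first by rewrite lt_min d10.
move=> h; rewrite lt_min => /andP[/H1 h1 /H2 h2].
have -> : rc (F1 (t + h)) + ci R * rc (F2 (t + h)) - (rc (F1 t) + ci R * rc (F2 t)) - rc h * u t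
  = rc (F1 (t + h) - F1 t - h * cre (u t)) + ci R * rc (F2 (t + h) - F2 t - h * cim (u t)).
  rewrite {1}(cre_cim (u t)) !(rcB, rcM); ring.
rewrite (le_trans (cabsD _ _)) // cabsM cabs_ci mul1r !cabs_rc; lra.
Qed.

Local Notation ci := (ci R).

Lemma rderivD U V t l m : rderiv U t l -> rderiv V t m ->
  rderiv (fun s => U s + V s) t (l + m).
Proof.
move=> dU dV e e0; have e20 : 0 < e / 2 by lra.
have [d1 d10 H1] := dU _ e20; have [d2 d20 H2] := dV _ e20.
exists (Num.min d1 d2); first by rewrite lt_min d10.
move=> h; rewrite lt_min => /andP[/H1 h1 /H2 h2].
have -> : U (t + h) + V (t + h) - (U t + V t) - rc h * (l + m) =
  (U (t + h) - U t - rc h * l) + (V (t + h) - V t - rc h * m) by ring.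
rewrite (le_trans (cabsD _ _)) //; lra.
Qed.

Lemma rderivZ (c : C) U t l : rderiv U t l -> rderiv (fun s => c * U s) t (c * l).
Proof.
move=> dU e e0.
have p0 : 0 < 1 + cabs c by have := cabs_ge0 c; lra.
have [|d d0 Hd] := dU (e / (1 + cabs c)); first by rewrite divr_gt0.
exists d => // h /Hd hd.
have -> : c * U (t + h) - c * U t - rc h * (c * l) =
   c * (U (t + h) - U t - rc h * l) by ring.
rewrite cabsM (le_trans (ler_wpM2l (cabs_ge0 _) hd)) // mulrA ler_wpM2r //.
rewrite mulrCA ger_pMr // ler_pdivrMr // mul1r; have := cabs_ge0 c; lra.
Qed.

Lemma rderivB U V t l m : rderiv U t l -> rderiv V t m ->
  rderiv (fun s => U s - V s) t (l - m).
Proof.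
move=> dU dV; have := rderivD dU (rderivZ (-1) dV).
by under [X in rderiv X]eq_fun do rewrite mulN1r; rewrite mulN1r.
Qed.

Lemma rcontB u v t : rcont u t -> rcont v t -> rcont (fun s => u s - v s) t.
Proof.
move=> cu cv e e0; have e20 : 0 < e / 2 by lra.
have [d1 d10 H1] := cu _ e20; have [d2 d20 H2] := cv _ e20.
exists (Num.min d1 d2); first by rewrite lt_min d10.
move=> h; rewrite lt_min => /andP[/H1 h1 /H2 h2].
have -> : u (t + h) - v (t + h) - (u t - v t) =
  (u (t + h) - u t) - (v (t + h) - v t) by ring.
rewrite (le_trans (cabsB _ _)) //; lra.
Qed.

Lemma rderiv0_const U a b : (forall t, rderiv U t 0) -> U b = U a.
Proof.
move=> dU; suff H x y : x <= y -> U y = U x.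
  by have [ab|/ltW ba] := leP a b; [exact: H|rewrite (H b a)].
move=> xy; have := rderiv_bound (u := fun=> 0) xy dU (M := 0).
rewrite mul0r => H; apply/eqP; rewrite -subr_eq0 -cabs_eq0 eq_le cabs_ge0 andbT.
by apply: H => t _; rewrite cabs0.
Qed.

(** Integrals enter only as increments of primitives. Additivity over adjacent
  intervals then holds by definition, whatever the order of the bounds. *)
Definition prim u : R -> C := xget (fun=> 0) [set U | forall t, rderiv U t (u t)].
Definition intg u a b : C := prim u b - prim u a.

Lemma intgE U u a b : (forall t, rderiv U t (u t)) -> intg u a b = U b - U a.
Proof.
move=> dU; have dP : forall t, rderiv (prim u) t (u t).
  by rewrite /prim; case: xgetP => [V _ //|/(_ U)].
rewrite /intg; apply/eqP; rewrite subr_eq addrC addrA addrAC -subr_eq; apply/eqP.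
apply: (@rderiv0_const (fun t => prim u t - U t)) => t.
by rewrite -(subrr (u t)); apply: rderivB.
Qed.

Lemma intg_bound u a b M : a <= b -> (forall t, rcont u t) ->
  (forall t, a <= t <= b -> cabs (u t) <= M) -> cabs (intg u a b) <= M * (b - a).
Proof.
move=> ab /rcont_prim[U dU] uM.
by rewrite (intgE a b dU); exact: rderiv_bound dU uM.
Qed.

Lemma intgB u v a b : (forall t, rcont u t) -> (forall t, rcont v t) ->
  intg (fun t => u t - v t) a b = intg u a b - intg v a b.
Proof.
move=> /rcont_prim[U dU] /rcont_prim[V dV].
rewrite (intgE a b dU) (intgE a b dV) (intgE a b (U := fun t => U t - V t)); first by ring.
by move=> t; exact: rderivB.
Qed.

Lemma intgZ (c : C) u a b : (forall t, rcont u t) ->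
  intg (fun t => c * u t) a b = c * intg u a b.
Proof.
move=> /rcont_prim[U dU].
rewrite (intgE a b dU) (intgE a b (U := fun t => c * U t)); first by ring.
by move=> t; exact: rderivZ.
Qed.

(** The chain rule along the line t |-> p + t d. *)
Lemma rderiv_line (f : C -> C) (p d l : C) (t : R) :
  is_derive (p + rc t * d) (1 : C) f l ->
  rderiv (fun s => f (p + rc s * d)) t (d * l).
Proof.
move=> /cderivP H e e0; have p0 : 0 < 1 + cabs d by have := cabs_ge0 d; lra.
have [|k k0 Hk] := H (e / (1 + cabs d)); first by rewrite divr_gt0.
have de h : cabs (rc h * d) <= `|h| * (1 + cabs d).
  by rewrite cabsM cabs_rc ler_wpM2l // lerDr.
exists (k / (1 + cabs d)); first by rewrite divr_gt0.
move=> h; rewrite ltr_pdivlMr // => hk.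
have := Hk (rc h * d) (le_lt_trans (de h) hk).
have -> : p + rc t * d + rc h * d = p + rc (t + h) * d by rewrite rcD; ring.
rewrite -mulrA => /le_trans; apply; rewrite -mulrA ler_pM2l //.
by rewrite mulrC ler_pdivrMr // (le_trans (de h)).
Qed.

Lemma rcont_line (f : C -> C) (p d : C) (t : R) :
  ccont f (p + rc t * d) -> rcont (fun s => f (p + rc s * d)) t.
Proof.
move=> H e e0; have [k k0 Hk] := H e e0.
have p0 : 0 < 1 + cabs d by have := cabs_ge0 d; lra.
exists (k / (1 + cabs d)); first by rewrite divr_gt0.
move=> h; rewrite ltr_pdivlMr // => hk.
have -> : p + rc (t + h) * d = p + rc t * d + rc h * d by rewrite rcD; ring.
apply: Hk; rewrite cabsM cabs_rc (le_lt_trans _ hk) // ler_wpM2l // lerDr //.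
Qed.

(** The integrals of G along a horizontal segment at height y and along a vertical
  one at abscissa x, both without the factor given by the direction. *)
Definition hor (G : C -> C) (y a b : R) := intg (fun t => G (ci * rc y + rc t * 1)) a b.
Definition ver (G : C -> C) (x a b : R) := intg (fun t => G (rc x + rc t * ci)) a b.
(** The contour integral of G around the rectangle [x1, x2] x [y1, y2]. *)
Definition rect G x1 x2 y1 y2 :=
  hor G y1 x1 x2 + ci * ver G x2 y1 y2 - hor G y2 x1 x2 - ci * ver G x1 y1 y2.

(** Each side contributes the increment of F between its ends. Used for affine G. *)
Lemma rect_prim (F G : C -> C) x1 x2 y1 y2 :
  (forall z, is_derive z (1 : C) F (G z)) -> rect G x1 x2 y1 y2 = 0.
Proof.
move=> dF.
have hE y : hor G y x1 x2 = F (ci * rc y + rc x2 * 1) - F (ci * rc y + rc x1 * 1).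
  apply: (intgE x1 x2 (U := fun t => F (ci * rc y + rc t * 1))) => t.
  by rewrite -[G _]mul1r; apply: rderiv_line.
have vE x : ver G x y1 y2 = - ci * F (rc x + rc y2 * ci) - (- ci * F (rc x + rc y1 * ci)).
  apply: (intgE y1 y2 (U := fun t => - ci * F (rc x + rc t * ci))) => t.
  have -> : G (rc x + rc t * ci) = - ci * (ci * G (rc x + rc t * ci)).
    by rewrite mulrA mulNr ci2 opprK mul1r.
  by apply/rderivZ/rderiv_line.
have cc (z : C) : ci * (ci * z) = - z by rewrite mulrA ci2 mulN1r.
have E x y : rc x + rc y * ci = ci * rc y + rc x * 1 :> C by rewrite mulr1 addrC [ci * _]mulrC.
rewrite /rect !hE !vE !E !mulNr !mulrDr !mulrN !cc; ring.
Qed.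

Lemma rectB (F G : C -> C) x1 x2 y1 y2 :
  (forall z, ccont F z) -> (forall z, ccont G z) ->
  rect (fun z => F z - G z) x1 x2 y1 y2 = rect F x1 x2 y1 y2 - rect G x1 x2 y1 y2.
Proof.
move=> cF cG; rewrite /rect /hor /ver !intgB; first by ring.
all: by move=> t; apply: rcont_line.
Qed.

Lemma rect_bound (G : C -> C) x1 x2 y1 y2 M : x1 <= x2 -> y1 <= y2 ->
  (forall z, ccont G z) ->
  (forall x y, x1 <= x <= x2 -> y1 <= y <= y2 -> cabs (G (rc x + ci * rc y)) <= M) ->
  cabs (rect G x1 x2 y1 y2) <= M * (2 * ((x2 - x1) + (y2 - y1))).
Proof.
move=> x12 y12 cG GM.
have hb y : y1 <= y <= y2 -> cabs (hor G y x1 x2) <= M * (x2 - x1).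
  move=> yy; apply: intg_bound => // t; first exact: rcont_line.
  by move=> tt; rewrite mulr1 addrC GM.
have vb x : x1 <= x <= x2 -> cabs (ver G x y1 y2) <= M * (y2 - y1).
  move=> yy; apply: intg_bound => // t; first exact: rcont_line.
  by move=> tt; rewrite [_ * ci]mulrC GM.
rewrite /rect (le_trans (cabsB _ _)) // cabsM cabs_ci mul1r.
have := hb y1; have := hb y2; have := vb x1; have := vb x2.
rewrite !lexx x12 y12 => /(_ isT) b1 /(_ isT) b2 /(_ isT) b3 /(_ isT) b4.
have := cabsB (hor G y1 x1 x2 + ci * ver G x2 y1 y2) (hor G y2 x1 x2).
have := cabsD (hor G y1 x1 x2) (ci * ver G x2 y1 y2).
rewrite cabsM cabs_ci mul1r; lra.
Qed.

Lemma nested_intervals (x l : nat -> R) : (forall n, 0 <= l n) ->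
  (forall n, x n <= x n.+1) -> (forall n, x n.+1 + l n.+1 <= x n + l n) ->
  exists p, forall n, x n <= p <= x n + l n.
Proof.
move=> l0 xm lm.
have xM i j : (i <= j)%N -> x i <= x j.
  by move=> /subnK <-; elim: (j - i)%N => // k IH; rewrite addSn (le_trans IH).
have lM i j : (i <= j)%N -> x j + l j <= x i + l i.
  by move=> /subnK <-; elim: (j - i)%N => // k IH; rewrite addSn (le_trans _ IH).
have ub n : ubound (range x) (x n + l n).
  move=> _ [m _ <-]; apply: (@le_trans _ _ (x (maxn m n))).
    by apply: xM; rewrite leq_maxl.
  apply: (@le_trans _ _ (x (maxn m n) + l (maxn m n))); first by rewrite lerDl.
  by apply: lM; rewrite leq_maxr.
exists (sup (range x)) => n; apply/andP; split; last first.
  by apply: ge_sup; [exists (x 0%N); exists 0%N|exact: ub].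
by apply: ub_le_sup; [exists (x 0%N + l 0%N); exact: ub|exists n].
Qed.

End ComplexIntegral.

(** * Goursat's theorem *)

Section Goursat.
Variable R : realType.
Local Notation C := (Cplx R).
Local Notation ci := (ci R).
Variables (G G' : C -> C).
Hypothesis dG : forall z, is_derive z (1 : C) G (G' z).

Let cG z : ccont G z. Proof. exact: cderiv_cont (dG z). Qed.

(** The inner sides cancel in pairs. *)
Lemma rect_quarter x1 xm x2 y1 ym y2 : rect G x1 x2 y1 y2 =
  rect G x1 xm y1 ym + rect G xm x2 y1 ym + rect G x1 xm ym y2 + rect G xm x2 ym y2.
Proof. rewrite /rect /hor /ver /intg; ring. Qed.

Lemma affine_deriv (a b p z : C) :
  is_derive z (1 : C) (fun w => (a - b * p) * w + b / 2 * w ^+ 2) (a + b * (z - p)).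
Proof.
apply/cderivP => e e0.
have p0 : 0 < 1 + cabs (b / 2) by have := cabs_ge0 (b / 2); lra.
exists (e / (1 + cabs (b / 2))); first by rewrite divr_gt0.
move=> h; rewrite ltr_pdivlMr // => he.
have -> : (a - b * p) * (z + h) + b / 2 * (z + h) ^+ 2 -
  ((a - b * p) * z + b / 2 * z ^+ 2) - h * (a + b * (z - p)) = (b / 2 * h) * h by field.
rewrite cabsM ler_wpM2r ?cabs_ge0 // cabsM.
have := cabs_ge0 h; nra.
Qed.

(** Near a point the contour integral is that of the difference between G and
  its affine approximation, as affine functions contribute 0. *)
Lemma rect_local (p q e : R) : 0 < e -> exists2 d : R, 0 < d &
  forall x1 x2 y1 y2, x1 <= p <= x2 -> y1 <= q <= y2 ->
    (x2 - x1) + (y2 - y1) < d ->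
    cabs (rect G x1 x2 y1 y2) <= 2 * e * ((x2 - x1) + (y2 - y1)) ^+ 2.
Proof.
move=> e0; set z := rc p + ci * rc q.
have [d d0 Hd] := (cderivP _ _ _).1 (dG z) e e0.
exists d => // x1 x2 y1 y2 /andP[px1 px2] /andP[qy1 qy2] ld.
(* A is the affine approximation of G at z, with an explicit primitive. *)
pose A w := G z + G' z * (w - z).
have dA w : is_derive w (1 : C) (fun w => (G z - G' z * z) * w + G' z / 2 * w ^+ 2) (A w).
  exact: affine_deriv.
have cA w : ccont A w.
  move=> k k0; have p0 : 0 < 1 + cabs (G' z) by have := cabs_ge0 (G' z); lra.
  exists (k / (1 + cabs (G' z))); first by rewrite divr_gt0.
  move=> h; rewrite ltr_pdivlMr // => hk.
  have -> : A (w + h) - A w = G' z * h by rewrite /A; ring.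
  by rewrite cabsM; have := cabs_ge0 h; nra.
have -> : rect G x1 x2 y1 y2 = rect (fun w => G w - A w) x1 x2 y1 y2.
  by rewrite rectB // (rect_prim x1 x2 y1 y2 dA) subr0.
have cGA w : ccont (fun w => G w - A w) w.
  move=> k k0; have k20 : 0 < k / 2 by lra.
  have [d1 d10 H1] := cG w k20; have [d2 d20 H2] := cA w _ k20.
  exists (Num.min d1 d2); first by rewrite lt_min d10.
  move=> h; rewrite lt_min => /andP[/H1 h1 /H2 h2].
  have -> : G (w + h) - A (w + h) - (G w - A w) = (G (w + h) - G w) - (A (w + h) - A w) by ring.
  rewrite (le_trans (cabsB _ _)) //; lra.
have -> : 2 * e * ((x2 - x1) + (y2 - y1)) ^+ 2 =
  e * ((x2 - x1) + (y2 - y1)) * (2 * ((x2 - x1) + (y2 - y1))) by ring.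
apply: rect_bound => //; try by apply: le_trans; eassumption.
move=> x y /andP[xx1 xx2] /andP[yy1 yy2].
set w := rc x + ci * rc y.
have hE : w - z = rc (x - p) + ci * rc (y - q) by rewrite /w /z !rcB; ring.
have hd : cabs (w - z) <= (x2 - x1) + (y2 - y1).
  rewrite hE (le_trans (cabsD _ _)) // cabsM cabs_ci mul1r !cabs_rc.
  by rewrite lerD // ler_norml; apply/andP; split; lra.
have := Hd (w - z) (le_lt_trans hd ld).
have -> : z + (w - z) = w by ring.
have -> : G w - G z - (w - z) * G' z = G w - A w by rewrite /A; ring.
by move/le_trans; apply; rewrite ler_wpM2l // ltW.
Qed.

(** Goursat by bisection. The bound 2 e (l + m)^2, with l and m the sides, is
  exactly the sum of the bounds of the four quarters; a rectangle violating it
  would have a quarter violating it, and the nested rectangles would shrink to a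
  point where [rect_local] gives a contradiction. *)
Lemma goursat_le x1 x2 y1 y2 : x1 <= x2 -> y1 <= y2 -> rect G x1 x2 y1 y2 = 0.
Proof.
move=> x12 y12; apply/eqP; rewrite -cabs_eq0 eq_le cabs_ge0 andbT.
set L := x2 - x1; set M := y2 - y1.
have L0 : 0 <= L by rewrite subr_ge0.
have M0 : 0 <= M by rewrite subr_ge0.
suff H e : 0 < e -> cabs (rect G x1 x2 y1 y2) <= 2 * e * (L + M) ^+ 2.
  apply/ler_addgt0Pr => e e0; rewrite add0r.
  have p0 : 0 < 1 + 2 * (L + M) ^+ 2 by rewrite ltr_pwDl // mulr_ge0 // sqr_ge0.
  apply: le_trans (H (e / (1 + 2 * (L + M) ^+ 2)) _) _; first by rewrite divr_gt0.
  rewrite mulrAC mulrCA ger_pMr // ler_pdivrMr // mul1r; lra.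
move=> e0; rewrite leNgt; apply/negP => bad0.
pose l n := L / 2 ^+ n; pose m n := M / 2 ^+ n.
have l0 n : 0 <= l n by rewrite divr_ge0 // exprn_ge0.
have m0 n : 0 <= m n by rewrite divr_ge0 // exprn_ge0.
have h2 n (x : R) : x / 2 ^+ n = x / 2 ^+ n.+1 + x / 2 ^+ n.+1.
  by rewrite exprS; field; rewrite expf_neq0 // pnatr_eq0.
pose bad n (c : R * R) := 2 * e * (l n + m n) ^+ 2 <
  cabs (rect G c.1 (c.1 + l n) c.2 (c.2 + m n)).
have step n c : bad n c -> exists c', bad n.+1 c' /\
   ((c'.1 = c.1 \/ c'.1 = c.1 + l n.+1) /\ (c'.2 = c.2 \/ c'.2 = c.2 + m n.+1)).
  move=> bc; apply: contrapT => /forallNP H.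
  have K c' : (c'.1 = c.1 \/ c'.1 = c.1 + l n.+1) /\ (c'.2 = c.2 \/ c'.2 = c.2 + m n.+1) ->
    cabs (rect G c'.1 (c'.1 + l n.+1) c'.2 (c'.2 + m n.+1)) <= 2 * e * (l n.+1 + m n.+1) ^+ 2.
    by move=> cc; rewrite leNgt; apply/negP => b; apply: (H c').
  move: bc; apply/negP; rewrite -leNgt.
  have lE : l n = l n.+1 + l n.+1 by exact: h2.
  have mE : m n = m n.+1 + m n.+1 by exact: h2.
  rewrite lE mE !addrA (rect_quarter _ (c.1 + l n.+1) _ _ (c.2 + m n.+1)).
  have D (a b c' d : C) B : cabs a <= B -> cabs b <= B -> cabs c' <= B -> cabs d <= B ->
    cabs (a + b + c' + d) <= 4 * B.
    move=> *; have := cabsD (a + b + c') d; have := cabsD (a + b) c'; have := cabsD a b; lra.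
  have -> : 2 * e * (l n.+1 + l n.+1 + m n.+1 + m n.+1) ^+ 2 =
    4 * (2 * e * (l n.+1 + m n.+1) ^+ 2) by ring.
  apply: D.
  - by apply: (K (c.1, c.2)) => /=; split; left.
  - by apply: (K (c.1 + l n.+1, c.2)) => /=; split; [right|left].
  - by apply: (K (c.1, c.2 + m n.+1)) => /=; split; [left|right].
  - by apply: (K (c.1 + l n.+1, c.2 + m n.+1)) => /=; split; right.
have /choice[f Hf] : forall nc : nat * (R * R), exists c', bad nc.1 nc.2 -> bad nc.1.+1 c' /\
   ((c'.1 = nc.2.1 \/ c'.1 = nc.2.1 + l nc.1.+1) /\ (c'.2 = nc.2.2 \/ c'.2 = nc.2.2 + m nc.1.+1)).
  move=> [n c]; have [/step[c' Hc']|nb] := pselect (bad n c); first by exists c'.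
  by exists (0, 0).
pose s := fix s n := if n is k.+1 then f (k, s k) else (x1, y1).
have sbad n : bad n (s n).
  elim: n => [|n IH] /=; last by case: (Hf (n, s n) IH).
  by rewrite /bad /l /m expr0 !divr1 /= (addrC x1) (addrC y1) !subrK.
have sS n := (Hf (n, s n) (sbad n)).2.
have lE n : l n = l n.+1 + l n.+1 by exact: h2.
have mE n : m n = m n.+1 + m n.+1 by exact: h2.
have [p Hp] : exists p, forall n, (s n).1 <= p <= (s n).1 + l n.
  by apply: nested_intervals => // n; case: (sS n).1 => /= ->; have := l0 n.+1; rewrite ?(lE n); lra.
have [q Hq] : exists q, forall n, (s n).2 <= q <= (s n).2 + m n.
  by apply: nested_intervals => // n; case: (sS n).2 => /= ->; have := m0 n.+1; rewrite ?(mE n); lra.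
have [d d0 Hd] := rect_local p q e0.
have [n nd] : exists n, l n + m n < d.
  have := cvg_geometric (L + M) (z := 2^-1 : R).
  rewrite ger0_norm ?invr_ge0 // invf_lt1 // ltr1n => /(_ isT) /cvgrPdist_lt /(_ d d0).
  move=> [n _ /(_ n (leqnn n))] /=; rewrite sub0r normrN => H; exists n.
  apply: le_lt_trans H; rewrite /l /m -mulrDl -exprVn; exact: ler_norm.
have := sbad n; apply/negP; rewrite -leNgt.
have E (a b : R) : a + b - a = b by ring.
have := Hd _ _ _ _ (Hp n) (Hq n); rewrite !E; exact.
Qed.

(** Reversing an orientation changes the sign on both sides, so the order of the
  corners does not matter. *)
Lemma goursat x1 x2 y1 y2 : rect G x1 x2 y1 y2 = 0.
Proof.
have swx a b c d : rect G a b c d = - rect G b a c d.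
  rewrite /rect /hor /ver /intg; ring.
have swy a b c d : rect G a b c d = - rect G a b d c.
  rewrite /rect /hor /ver /intg; ring.
have [x12|/ltW x12] := leP x1 x2; have [y12|/ltW y12] := leP y1 y2.
- exact: goursat_le.
- by rewrite swy goursat_le ?oppr0.
- by rewrite swx goursat_le ?oppr0.
- by rewrite swx swy goursat_le ?oppr0.
Qed.

End Goursat.

(** * The exponential and Cauchy's formula *)

Section Cauchy.
Variable R : realType.
Local Notation C := (Cplx R).
Local Notation ci := (ci R).

Lemma cderiv_comp (f g : C -> C) (w l m : C) :
  is_derive w (1 : C) g m -> is_derive (g w) (1 : C) f l ->
  is_derive w (1 : C) (fun z => f (g z)) (m * l).
Proof.
move=> /cderivP dg /cderivP df; apply/cderivP => e e0.
set A := cabs m + 1; set B := cabs l + 1.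
have A0 : 0 < A by rewrite ltr_pwDr // cabs_ge0.
have B0 : 0 < B by rewrite ltr_pwDr // cabs_ge0.
have e1 : 0 < e / 2 / A by rewrite !divr_gt0.
have e2 : 0 < e / 2 / B by rewrite !divr_gt0.
have [d1 d10 H1] := df _ e1; have [d2 d20 H2] := dg _ e2.
have [d3 d30 H3] := dg _ ltr01.
exists (Num.min (d1 / A) (Num.min d2 d3)); first by rewrite !lt_min divr_gt0 // d20.
move=> h; rewrite !lt_min => /and3P[h1 /H2 h2 /H3 h3].
set k := g (w + h) - g w.
have kh : cabs k <= A * cabs h.
  rewrite -(subrK (h * m) k) (le_trans (cabsD _ _)) // cabsM /A mulrDl mul1r addrC.
  by rewrite (mulrC (cabs h)) lerD2l -[leRHS]mul1r.
have := H1 k; rewrite (le_lt_trans kh) => [/(_ isT)|]; last first.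
  by move: h1; rewrite ltr_pdivlMr // mulrC.
have -> : g w + k = g (w + h) by rewrite /k; ring.
move=> hk.
have -> : f (g (w + h)) - f (g w) - h * (m * l) =
  (f (g (w + h)) - f (g w) - k * l) + (k - h * m) * l by ring.
rewrite (le_trans (cabsD _ _)) // cabsM.
have E1 : e / 2 / A * cabs k <= e / 2 * cabs h.
  by rewrite -mulrA ler_pM2l ?divr_gt0 // mulrC ler_pdivrMr // mulrC.
have E2 : cabs (k - h * m) * cabs l <= e / 2 * cabs h.
  apply: (@le_trans _ _ (e / 2 / B * cabs h * B)).
    by rewrite ler_pM ?cabs_ge0 // /B lerDl.
  by rewrite mulrAC divfK // gt_eqF.
lra.
Qed.

Definition cexp (z : C) : C := rc (expR (cre z)) * (rc (cos (cim z)) + ci * rc (sin (cim z))).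

Lemma cexpD z w : cexp (z + w) = cexp z * cexp w.
Proof.
rewrite /cexp creD cimD expRD cosD sinD !(rcB, rcD, rcM).
set a := rc (expR (cre z)); set b := rc (expR (cre w)).
set c := rc (cos (cim z)); set d := rc (sin (cim z)).
set p := rc (cos (cim w)); set q := rc (sin (cim w)).
have -> : a * (c + ci * d) * (b * (p + ci * q)) = a * b * (c * p + (ci * ci) * (d * q) + ci * (d * p + c * q)) by ring.
by rewrite ci2 mulN1r [d * p + _]addrC.
Qed.

Lemma cabs_cexp z : cabs (cexp z) = expR (cre z).
Proof.
rewrite /cexp cabsM cabs_rc ger0_norm ?expR_ge0 // -[RHS]mulr1; congr (_ * _).
have := cre_rc (cos (cim z)) (sin (cim z)); have := cim_rc (cos (cim z)) (sin (cim z)).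
case: (_ + _) => a b; rewrite /cre /cim /= => -> ->.
by rewrite cos2Dsin2 sqrtr1.
Qed.

Lemma cexp0 : cexp 0 = 1.
Proof. by rewrite /cexp /cre /cim /= expR0 cos0 sin0 mulr0 addr0 mulr1. Qed.

Lemma cexp_neq0 z : cexp z != 0.
Proof. by rewrite -cabs_gt0 cabs_cexp expR_gt0. Qed.

Lemma cexpN z : cexp (- z) = (cexp z)^-1.
Proof.
apply: (mulIf (cexp_neq0 z)); rewrite mulVf ?cexp_neq0 //.
by rewrite -cexpD addNr cexp0.
Qed.

Lemma cexp_2pi z : cexp (z + ci * rc (2 * pi)) = cexp z.
Proof.
rewrite cexpD.
have -> : cexp (ci * rc (2 * pi)) = 1; last by rewrite mulr1.
have -> : ci * rc (2 * pi) = rc 0 + ci * rc (2 * pi) by rewrite rc0 add0r.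
rewrite /cexp cre_rc cim_rc expR0 mulr_natl cos2pi sin2pi.
by rewrite rc0 mulr0 addr0 mulr1.
Qed.

(** With c = cos y - 1, s = sin y - y and g = e^x - 1 - x, all o(h), the real and
  imaginary parts of e^h - 1 - h are sums of products containing c, s, g or x y. *)
Lemma cexp_deriv0 : is_derive (0 : C) (1 : C) cexp 1.
Proof.
apply/cderivP => e e0.
have [k k0 [ke k1]] : exists2 k : R, 0 < k & k <= e / 9 /\ k <= 1.
  exists (Num.min (e / 9) 1); first by rewrite lt_min ltr01 andbT divr_gt0.
  by rewrite !ge_min !lexx orbT.
have [d1 d10 H1] := (is_deriveP _ _ _).1 (is_derive_expR (0 : R)) k k0.
have [d2 d20 H2] := (is_deriveP _ _ _).1 (is_derive_sin (0 : R)) k k0.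
have [d3 d30 H3] := (is_deriveP _ _ _).1 (is_derive_cos (0 : R)) k k0.
exists (Num.min k (Num.min d1 (Num.min d2 d3))); first by rewrite !lt_min k0 d10 d20.
move=> h; rewrite !lt_min => /and4P[hk h1 h2 h3].
set x := cre h; set y := cim h.
have xh : `|x| <= cabs h := cre_le h.
have yh : `|y| <= cabs h := cim_le h.
have := H1 x (le_lt_trans xh h1); have := H2 y (le_lt_trans yh h2).
have := H3 y (le_lt_trans yh h3).
rewrite !add0r expR0 cos0 sin0 oppr0 mulr0 !mulr1 !(subr0, addr0) => h3' h2' h1'.
rewrite cexp0.
set c := cos y - 1 in h3'; set s := sin y - y in h2'; set g := expR x - 1 - x in h1'.
have -> : cexp h - 1 - h = rc (g + c * (1 + x + g)) + ci * rc (s * (1 + x + g) + x * y + g * y).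
  rewrite [in LHS](cre_cim h) -/x -/y /cexp cre_rc cim_rc.
  have -> : expR x = g + 1 + x by rewrite /g; ring.
  have -> : cos y = c + 1 by rewrite /c; ring.
  have -> : sin y = s + y by rewrite /s; ring.
  rewrite !(rcD, rcM) rc1; ring.
rewrite (le_trans (cabsD _ _)) // cabsM cabs_ci mul1r !cabs_rc.
set r := cabs h in xh yh hk *.
have r0 : 0 <= r by exact: cabs_ge0.
have x1 : `|x| <= k by exact/ltW/(le_lt_trans xh).
have y1 : `|y| <= k by exact/ltW/(le_lt_trans yh).
have gk : `|g| <= k * r by rewrite (le_trans h1') // ler_wpM2l // ltW.
have ck : `|c| <= k * r by rewrite (le_trans h3') // ler_wpM2l // ltW.
have sk : `|s| <= k * r by rewrite (le_trans h2') // ler_wpM2l // ltW.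
have kr : k * r <= 1 by have := ltW hk; nra.
have b3 : `|1 + x + g| <= 3.
  rewrite (le_trans (ler_normD _ _)) // (le_trans (lerD (ler_normD _ _) (lexx _))) // normr1; lra.
have cb : `|c * (1 + x + g)| <= k * r * 3 by rewrite normrM ler_pM.
have sb : `|s * (1 + x + g)| <= k * r * 3 by rewrite normrM ler_pM.
have xyb : `|x * y| <= k * r by rewrite normrM ler_pM.
have gyb : `|g * y| <= k * r by rewrite normrM -[leRHS]mulr1 ler_pM // (le_trans y1).
have := ler_normD g (c * (1 + x + g)).
have := ler_normD (s * (1 + x + g) + x * y) (g * y).
have := ler_normD (s * (1 + x + g)) (x * y).
have : 9 * (k * r) <= e * r by rewrite mulrA ler_wpM2r // mulrC -ler_pdivlMr.
lra.
Qed.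

Lemma cexp_deriv z : is_derive z (1 : C) cexp (cexp z).
Proof.
apply/cderivP => e e0.
have z0 : 0 < expR (cre z) by exact: expR_gt0.
have [d d0 Hd] := (cderivP _ _ _).1 cexp_deriv0 (e / expR (cre z)) (divr_gt0 e0 z0).
exists d => // h /Hd; rewrite add0r cexp0 mulr1 cexpD.
have -> : cexp z * cexp h - cexp z - h * cexp z = cexp z * (cexp h - 1 - h) by ring.
rewrite cabsM cabs_cexp => H; rewrite (le_trans (ler_wpM2l (ltW z0) H)) //.
by rewrite mulrA mulrCA divff ?mulr1 // gt_eqF.
Qed.

Lemma cexpN_deriv z : is_derive z (1 : C) (fun w => cexp (- w)) (- cexp (- z)).
Proof. by rewrite -mulN1r; apply: cderiv_comp (cexp_deriv _). Qed.

Variables (f f' : C -> C).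
Hypothesis df : forall z, is_derive z (1 : C) f (f' z).

(** In the coordinate w = log (u - z) a circle around z becomes a vertical segment
  of length 2 pi. The factor e^(-w) makes the mean over a circle pick the
  coefficient f'(z). *)
Definition polar (z w : C) := f (z + cexp w) * cexp (- w).

Lemma polar_deriv z w : is_derive w (1 : C) (polar z)
  (f (z + cexp w) * (- cexp (- w)) + cexp (- w) * (cexp w * f' (z + cexp w))).
Proof.
apply: is_deriveM; last exact: cexpN_deriv.
have dg : is_derive w (1 : C) (fun w => z + cexp w) (cexp w).
  by rewrite -[X in is_derive _ _ _ X]add0r; apply: is_deriveD; exact: cexp_deriv.
exact: cderiv_comp dg (df _).
Qed.

Lemma polar_cont z w : ccont (polar z) w.
Proof. exact: cderiv_cont (polar_deriv z w). Qed.

(** By periodicity the two horizontal sides of a rectangle of height 2 pi cancel. *)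
Lemma polar_radius z x y : ver (polar z) x 0 (2 * pi) = ver (polar z) y 0 (2 * pi).
Proof.
have := goursat (polar_deriv z) x y 0 (2 * pi).
rewrite /rect; have -> : hor (polar z) (2 * pi) x y = hor (polar z) 0 x y.
  rewrite /hor; congr intg; apply/funext => t.
  rewrite rc0 mulr0 add0r addrC /polar cexp_2pi !cexpN.
  by rewrite cexp_2pi.
move=> H; have c0 : ci != 0 by rewrite -cabs_gt0 cabs_ci.
apply/esym/(mulfI c0)/eqP; rewrite -subr_eq0 -H.
by move: (hor _ _ _ _) (ver _ _ _ _) (ver _ _ _ _) => a b c; apply/eqP; ring.
Qed.

(** The left side does not depend on x. On a small circle f is f(z) + e^w f'(z)
  up to o(e^w); the first term contributes 0 because e^(-w) has a periodic
  primitive, and the second one 2 pi f'(z). *)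
Lemma cauchy_deriv z x : ver (polar z) x 0 (2 * pi) = rc (2 * pi) * f' z.
Proof.
have p0 : 0 < 2 * pi :> R by rewrite mulr_gt0 // pi_gt0.
apply/eqP; rewrite -subr_eq0 -cabs_eq0 eq_le cabs_ge0 andbT.
apply/ler_addgt0Pr => e e0; rewrite add0r.
have e1 : 0 < e / (2 * pi) by rewrite divr_gt0.
have [d d0 Hd] := (cderivP _ _ _).1 (df z) _ e1.
(* The radius d / 2 lies in the disc where the first-order expansion holds. *)
rewrite (polar_radius z x (ln (d / 2))); set y := ln (d / 2).
have yE : expR y = d / 2 by rewrite lnK // posrE divr_gt0.
pose w t : C := rc y + rc t * ci.
have wE t : cabs (cexp (w t)) = d / 2.
  by rewrite cabs_cexp -yE /w mulrC cre_rc.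
pose v t := f z * cexp (- w t) + f' z.
have dv t : rderiv (fun t => f z * ci * cexp (- w t) + f' z * rc t) t (v t).
  apply: rderivD.
    have -> : f z * cexp (- w t) = f z * ci * (ci * - cexp (- w t)).
      have -> : f z * ci * (ci * - cexp (- w t)) = (ci * ci) * (f z * - cexp (- w t)) by ring.
      by rewrite ci2; ring.
    apply: rderivZ; apply: (rderiv_line (f := fun w => cexp (- w))); exact: cexpN_deriv.
  rewrite -[X in rderiv _ _ X]mulr1; apply: rderivZ.
  move=> k k0; exists 1 => // h _.
  have -> : rc (t + h) - rc t - rc h * 1 = 0 :> C by rewrite rcD; ring.
  by rewrite cabs0 mulr_ge0 // ltW.
have vI : intg v 0 (2 * pi) = rc (2 * pi) * f' z.
  rewrite (intgE _ _ dv) rc0 mulr0 addr0 !cexpN.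
  have -> : w (2 * pi) = w 0 + ci * rc (2 * pi) by rewrite /w rc0; ring.
  rewrite cexp_2pi; ring.
have cv t : rcont v t.
  move=> k k0; have : is_derive (rc y + rc t * ci) (1 : C) (fun w => f z * cexp (- w) + f' z) (f z * - cexp (- (rc y + rc t * ci)) + 0).
    by apply: is_deriveD; apply: is_deriveZ; exact: cexpN_deriv.
  move/cderiv_cont => H.
  exact: (rcont_line (f := fun w => f z * cexp (- w) + f' z) H k0).
have cp t : rcont (fun t => polar z (w t)) t.
  by apply: rcont_line; exact: polar_cont.
rewrite -vI -[ver _ _ _ _]/(intg (fun t => polar z (w t)) 0 (2 * pi)).
rewrite -intgB //.
have -> : e = e / (2 * pi) * (2 * pi - 0) by rewrite subr0 divfK // gt_eqF.
apply: intg_bound => //; first exact: ltW.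
  by move=> t; exact: rcontB.
move=> t _; have wd : cabs (cexp (w t)) < d by rewrite wE; lra.
have := Hd _ wd.
have -> : polar z (w t) - v t = (f (z + cexp (w t)) - f z - cexp (w t) * f' z) * cexp (- w t).
  rewrite /polar /v !mulrBl [cexp _ * _ * _]mulrAC -[cexp (w t) * cexp _]cexpD subrr cexp0; ring.
rewrite [in X in _ -> X]cabsM cexpN cabsV => H.
by rewrite ler_pdivrMr ?cabs_gt0 ?cexp_neq0.
Qed.

Lemma cauchy_estimate z r B : 0 < r -> (forall w, cabs w = r -> cabs (f (z + w)) <= B) ->
  cabs (f' z) <= B / r.
Proof.
move=> r0 fB; have p0 : 0 < 2 * pi :> R by rewrite mulr_gt0 // pi_gt0.
have rE : expR (ln r) = r by rewrite lnK // posrE.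
have := congr1 (@cabs R) (cauchy_deriv z (ln r)).
rewrite cabsM cabs_rc gtr0_norm // => H.
rewrite -(ler_pM2l p0) -H.
have -> : 2 * pi * (B / r) = B / r * (2 * pi - 0) by rewrite subr0 mulrC.
apply: intg_bound; first exact: ltW.
  by move=> t; apply: rcont_line; exact: polar_cont.
move=> t _; rewrite /polar cabsM cexpN cabsV cabs_cexp mulrC [rc t * _]mulrC cre_rc rE.
by rewrite mulrC ler_pM2r ?invr_gt0 // fB // cabs_cexp cre_rc rE.
Qed.

End Cauchy.

(** * Liouville's theorem *)

Section Liouville.
Variable R : realType.
Local Notation C := (Cplx R).
Local Notation ci := (ci R).

Lemma ccontP (f : C -> C) z : ccont f z <-> {for z, continuous f}.
Proof.
rewrite /prop_for /continuous_at; split=> [H|/cvgrPdist_le H].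
  apply/(cvgrPdist_le (FF := @nbhs_filter C z)) => e e0; apply: (proj2 (nbhsCP _ _)).
  have eE : e = rc (cabs e) by rewrite -normE gtr0_norm.
  have [|d d0 Hd] := H (cabs e); first by rewrite -rc_lt -eE.
  exists d => // w /Hd; have -> : z + (w - z) = w by ring.
  by rewrite normE [in X in _ -> X]eE rc_le cabsBC.
move=> e e0; have [|d d0 Hd] := (nbhsCP _ _).1 (H (rc e) _).
  by rewrite -[0]rc0 rc_lt.
exists d => // h hd; have := Hd (z + h).
have -> : z + h - z = h by ring.
by rewrite normE rc_le cabsBC; exact.
Qed.

Lemma is_derive_hornerC (p : {poly C}) (z : C) : is_derive z (1 : C) (horner p) p^`().[z].
Proof.
elim/poly_ind: p => [|p c IH].
  rewrite deriv0 horner0; have -> : horner 0 = cst 0 :> (C -> C).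
    by apply/funext => y; rewrite horner0.
  exact: is_derive_cst.
have -> : horner (p * 'X + c%:P) = (horner p : C -> C) * id + cst c.
  by apply/funext => y; rewrite !(hornerE, fctE).
apply: is_derive_eq; rewrite addr0 derivMXaddC !hornerE /=.
by rewrite /GRing.scale /= mulr1 [z * _]mulrC.
Qed.

Lemma poly_antideriv (p : {poly C}) : exists P : {poly C}, P^`() = p.
Proof.
exists (\poly_(i < (size p).+1) (p`_i.-1 / i%:R)).
apply/polyP => i; rewrite coef_deriv coef_poly ltnS /=.
case: ltnP => [_|/leq_sizeP -> //]; last by rewrite mul0rn.
by rewrite -[LHS]mulr_natr divfK // pnatr_eq0.
Qed.

Lemma mean_value (f f' : C -> C) (u h : C) M : (forall z, is_derive z (1 : C) f (f' z)) ->
  (forall t : R, 0 <= t <= 1 -> cabs (f' (u + rc t * h)) <= M) ->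
  cabs (f (u + h) - f u) <= M * cabs h.
Proof.
move=> df fM.
have dl t : rderiv (fun s => f (u + rc s * h)) t (h * f' (u + rc t * h)).
  exact: rderiv_line.
have := rderiv_bound (M := M * cabs h) ler01 dl.
rewrite rc0 rc1 mul0r mul1r addr0 subr0 mulr1; apply => t t01.
by rewrite cabsM mulrC ler_wpM2r ?cabs_ge0 // fM.
Qed.

Lemma deriv0_const (f : C -> C) : (forall z, is_derive z (1 : C) f 0) -> forall z, f z = f 0.
Proof.
move=> df z; apply/eqP; rewrite -subr_eq0 -cabs_eq0 eq_le cabs_ge0 andbT.
have := @mean_value f (fun=> 0) 0 z 0 df; rewrite mul0r add0r; apply.
by move=> t _; rewrite cabs0.
Qed.

Definition poly_growth (f : C -> C) (N : nat) :=
  exists A : R, forall z, cabs (f z) <= A * (1 + cabs z) ^+ N.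

(** Cauchy's estimate on the circle of radius 1 + |z|. *)
Lemma poly_growth_deriv (f f' : C -> C) N :
  (forall z, is_derive z (1 : C) f (f' z)) -> poly_growth f N.+1 -> poly_growth f' N.
Proof.
move=> df [A fA]; exists (A * 2 ^+ N.+1) => z.
have r0 : 0 < 1 + cabs z by rewrite ltr_pwDl // cabs_ge0.
have A0 : 0 <= A.
  have := le_trans (cabs_ge0 _) (fA 0); by rewrite cabs0 addr0 expr1n mulr1.
have := cauchy_estimate df (z := z) (B := A * (2 * (1 + cabs z)) ^+ N.+1) r0.
have -> : A * (2 * (1 + cabs z)) ^+ N.+1 / (1 + cabs z) = A * 2 ^+ N.+1 * (1 + cabs z) ^+ N.
  by rewrite exprMn [_ ^+ N.+1 in X in _ * (_ * X)]exprS; field; rewrite gt_eqF.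
apply => w wr; rewrite (le_trans (fA _)) // ler_wpM2l // lerXn2r ?nnegrE //.
- by rewrite addr_ge0 ?cabs_ge0.
- by rewrite mulr_ge0 // ltW.
- have := cabsD z w; lra.
Qed.

(** Differentiating Cauchy's formula on the circle of radius 1 under the integral.
  The derivative f' is bounded on discs by Cauchy's estimate, hence locally
  Lipschitz by the same estimate for f(. + h) - f, and so the first-order
  remainder of f is O(|h|^2) uniformly on the circle. *)
Lemma deriv_entire (f f' : C -> C) N :
  (forall z, is_derive z (1 : C) f (f' z)) -> poly_growth f N ->
  exists f'' : C -> C, forall z, is_derive z (1 : C) f' (f'' z).
Proof.
move=> df [A fA].
have p0 : 0 < 2 * pi :> R by rewrite mulr_gt0 // pi_gt0.
have A0 : 0 <= A.
  have := le_trans (cabs_ge0 _) (fA 0); by rewrite cabs0 addr0 expr1n mulr1.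
pose B (k : R) := A * (2 + k) ^+ N.
have B0 k : 0 <= k -> 0 <= B k by move=> k0; rewrite mulr_ge0 // exprn_ge0 //; lra.
have f'B k u : cabs u <= k -> cabs (f' u) <= B k.
  move=> uk; have := cauchy_estimate df (z := u) (B := B k) ltr01.
  rewrite divr1; apply => w w1; rewrite (le_trans (fA _)) // ler_wpM2l // lerXn2r ?nnegrE //.
  - by rewrite addr_ge0 ?cabs_ge0.
  - have := cabs_ge0 u; lra.
  - have := cabsD u w; lra.
have f'L k u h : cabs u + 1 + cabs h <= k -> cabs (f' (u + h) - f' u) <= B k * cabs h.
  move=> uk; have dg z : is_derive z (1 : C) (fun z => f (z + h) - f z) (f' (z + h) - f' z).
    apply: is_deriveB; rewrite -[f' _]mul1r.
    apply: (cderiv_comp (g := fun z => z + h)) => //.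
    by rewrite -[X in is_derive _ _ _ X]addr0; apply: is_deriveD.
  have := cauchy_estimate dg (z := u) (B := B k * cabs h) ltr01.
  rewrite divr1; apply => w w1; apply: mean_value => // t /andP[t0 t1].
  apply: f'B; have := cabsD (u + w) (rc t * h); have := cabsD u w.
  rewrite cabsM cabs_rc ger0_norm //; have := cabs_ge0 h; nra.
(* The first-order remainder, by the mean value inequality for f - f'(u) id. *)
have f2 k u h : cabs u + 1 + cabs h <= k ->
    cabs (f (u + h) - f u - h * f' u) <= B k * cabs h * cabs h.
  move=> uk; have dg z : is_derive z (1 : C) (fun z => f z - f' u * z) (f' z - f' u).
    by apply: is_deriveB; rewrite -[X in is_derive _ _ _ X]mulr1; apply: is_deriveZ.
  have -> : f (u + h) - f u - h * f' u = (f (u + h) - f' u * (u + h)) - (f u - f' u * u) by ring.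
  apply: mean_value dg _ => t /andP[t0 t1].
  have th : cabs (rc t * h) <= cabs h.
    by rewrite cabsM cabs_rc ger0_norm //; have := cabs_ge0 h; nra.
  have := f'L k u (rc t * h); rewrite (le_trans _ uk) ?lerD2l // => /(_ isT) /le_trans; apply.
  rewrite ler_wpM2l // B0 //; have := cabs_ge0 u; have := cabs_ge0 h; lra.
have cf' z : ccont f' z.
  move=> e e0; have K0 : 0 <= B (cabs z + 2) by apply: B0; have := cabs_ge0 z; lra.
  exists (Num.min 1 (e / (1 + B (cabs z + 2)))).
    by rewrite lt_min ltr01 divr_gt0 //; lra.
  move=> h; rewrite lt_min => /andP[h1]; rewrite ltr_pdivlMr; last by lra.
  move=> he; apply: le_trans (f'L (cabs z + 2) z h _) _; first by lra.
  by have := cabs_ge0 h; nra.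
have cF z t : ccont (fun w => f' (z + cexp w) * cexp (- w)) t.
  apply/ccontP; apply: continuousM; last first.
    by apply/ccontP; exact: cderiv_cont (cexpN_deriv _).
  apply: (continuous_comp (f := fun w => z + cexp w)); last exact/ccontP.
  apply: continuousD; first exact: cst_continuous.
  by apply/ccontP; exact: cderiv_cont (cexp_deriv _).
exists (fun z => rc (2 * pi)^-1 * ver (fun w => f' (z + cexp w) * cexp (- w)) 0 0 (2 * pi)) => z.
have f'E u : f' u = rc (2 * pi)^-1 * ver (polar f u) 0 0 (2 * pi).
  rewrite (cauchy_deriv df) mulrA -rcM mulVf ?mul1r // gt_eqF //.
apply/cderivP => e e0; have K0 : 0 <= B (cabs z + 3) by apply: B0; have := cabs_ge0 z; lra.
exists (Num.min 1 (e / (1 + B (cabs z + 3)))).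
  by rewrite lt_min ltr01 divr_gt0 //; lra.
move=> h; rewrite lt_min => /andP[h1]; rewrite ltr_pdivlMr; last by lra.
move=> he.
apply: (@le_trans _ _ (B (cabs z + 3) * cabs h * cabs h)); last first.
  by have := cabs_ge0 h; nra.
rewrite !f'E mulrCA -!mulrBr cabsM cabs_rc gtr0_norm ?invr_gt0 //.
rewrite mulrC ler_pdivrMr // -[2 * pi]subr0 /ver.
have cp u t : rcont (fun t => polar f u (rc 0 + rc t * ci)) t.
  by apply: rcont_line; exact: polar_cont.
have cFt t : rcont (fun t => f' (z + cexp (rc 0 + rc t * ci)) * cexp (- (rc 0 + rc t * ci))) t.
  by apply: (rcont_line (f := fun w => f' (z + cexp w) * cexp (- w))); exact: cF.
have chF t : rcont (fun t => h * (f' (z + cexp (rc 0 + rc t * ci)) * cexp (- (rc 0 + rc t * ci)))) t.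
  have := rcont_line (f := fun w => h * (f' (z + cexp w) * cexp (- w))) (p := rc 0) (d := ci) (t := t).
  by apply; apply/ccontP; apply: continuousM; [exact: cst_continuous|exact/ccontP].
rewrite subr0 -intgZ // -!intgB //; last by move=> t; exact: rcontB.
rewrite -[X in _ <= _ * X]subr0.
apply: intg_bound; [exact: ltW| by move=> t; apply: rcontB => //; exact: rcontB|].
move=> t _; rewrite /polar; set w := rc 0 + rc t * ci.
have w1 : cabs (cexp w) = 1 by rewrite cabs_cexp /w mulrC cre_rc expR0.
have -> : f (z + h + cexp w) * cexp (- w) - f (z + cexp w) * cexp (- w) - h * (f' (z + cexp w) * cexp (- w))
  = (f (z + cexp w + h) - f (z + cexp w) - h * f' (z + cexp w)) * cexp (- w).
  have -> : z + h + cexp w = z + cexp w + h by ring.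
  by ring.
rewrite cabsM cexpN cabsV w1 invr1 mulr1; apply: f2.
have := cabsD z (cexp w); lra.
Qed.

(** By induction on the degree of growth: f' is entire and grows one degree less. *)
Lemma liouville (f f' : C -> C) N :
  (forall z, is_derive z (1 : C) f (f' z)) -> poly_growth f N ->
  exists p : {poly C}, forall z, f z = p.[z].
Proof.
elim: N f f' => [|N IH] f f' df fN.
  have [A fA] := fN; exists (f 0)%:P => z; rewrite hornerC; apply: deriv0_const => u.
  suff <- : f' u = 0 by exact: df.
  apply/eqP; rewrite -cabs_eq0 eq_le cabs_ge0 andbT.
  apply/ler_addgt0Pr => e e0; rewrite add0r.
  have A0 : 0 <= A by have := le_trans (cabs_ge0 _) (fA 0); rewrite mulr1.
  have r0 : 0 < (1 + A) / e by rewrite divr_gt0 //; lra.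
  apply: (le_trans (cauchy_estimate df (B := A) r0 _)).
    by move=> w _; have := fA (u + w); rewrite mulr1.
  rewrite invf_div mulrA ler_pdivrMr; last by lra.
  by rewrite mulrC ler_wpM2l ?(ltW e0) //; lra.
have [f'' df'] := deriv_entire df fN.
have [p fp] := IH _ _ df' (poly_growth_deriv df fN).
have [P PE] := poly_antideriv p.
exists (P + (f 0 - P.[0])%:P) => z; rewrite hornerD hornerC.
have := @deriv0_const (fun z => f z - P.[z]).
have d u : is_derive u (1 : C) (fun z => f z - P.[z]) 0.
  rewrite -(subrr (f' u)); apply: is_deriveB; rewrite fp -PE.
  exact: is_derive_hornerC.
by move=> /(_ d z) /eqP; rewrite subr_eq addrC => /eqP.
Qed.

End Liouville.

(** * Meromorphic functions on the sphere are rational *)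

Section Meromorphic.
Variable R : realType.
Local Notation C := (Cplx R).
Local Notation ci := (ci R).
Local Notation CP1 := (one_point_compactification C).

Lemma cabs_continuous : continuous (@cabs R : C -> R).
Proof.
move=> z; apply/(cvgrPdist_le (FF := @nbhs_filter C z)) => e e0; apply: (proj2 (nbhsCP _ _)).
exists e => // w wz; apply: le_trans (ltW wz); rewrite ler_norml.
have := cabsD (w - z) z; have := cabsB w (w - z).
have -> : w - (w - z) = z by ring.
have -> : w - z + z = w by ring.
lra.
Qed.

(** The plane is the image of a product of two real lines, whose closed squares
  are compact. *)
Lemma compact_disc (r : R) : compact [set z : C | cabs z <= r].
Proof.
pose g (x : R * R) : C := rc x.1 + ci * rc x.2.
have cg : continuous g.
  move=> x; apply/(cvgrPdist_le (FF := @nbhs_filter _ x)) => e e0.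
  have eE : e = rc (cabs e) by rewrite -normE gtr0_norm.
  have e20 : 0 < cabs e / 2 by rewrite divr_gt0 // cabs_gt0 gt_eqF.
  exists (ball x.1 (cabs e / 2), ball x.2 (cabs e / 2)).
    by split; apply: nbhsx_ballx.
  move=> [a b] [/= xa xb].
  have -> : g x - g (a, b) = rc (x.1 - a) + ci * rc (x.2 - b) by rewrite /g /= !rcB; ring.
  rewrite normE [X in _ <= X]eE rc_le (le_trans (cabsD _ _)) // cabsM cabs_ci mul1r !cabs_rc.
  move: xa xb; rewrite -!ball_normE /ball_ /=; lra.
apply: (@subclosed_compact _ _ (g @` (`[- r, r] `*` `[- r, r]))).
- have -> : [set z : C | cabs z <= r] = @cabs R @^-1` [set x | x <= r] by [].
  by apply: closed_comp; [move=> z _; exact: cabs_continuous|exact: closed_le].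
- apply: continuous_compact; first exact: continuous_subspaceT.
  by apply: compact_setX; exact: segment_compact.
- move=> z /= zr; exists (cre z, cim z); last by rewrite /g /= -cre_cim.
  have := le_trans (cre_le z) zr; have := le_trans (cim_le z) zr.
  by split; rewrite /= in_itv /= -ler_norml.
Qed.

Lemma closed_disc (r : R) : closed [set z : C | cabs z <= r].
Proof.
have -> : [set z : C | cabs z <= r] = @cabs R @^-1` [set x | x <= r] by [].
by apply: closed_comp; [move=> z _; exact: cabs_continuous|exact: closed_le].
Qed.

(** Closed discs are compact, so their complements are neighbourhoods of infinity. *)
Lemma nbhs_infty (r : R) (A : set CP1) : A None ->
  (forall z, r < cabs z -> A (Some z)) -> nbhs (None : CP1) A.
Proof.
move=> A0 AS; exists [set z : C | cabs z <= r].
  by split; [exact: compact_disc|exact: closed_disc].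
move=> x [[z /= zr <-]|->] //; apply: AS; rewrite ltNge; exact/negP.
Qed.

Lemma dnbhsCP (z : C) (A : set C) :
  nbhs z^' A <-> exists2 d : R, 0 < d & forall w, cabs (w - z) < d -> w != z -> A w.
Proof. exact: (nbhsCP z (fun w => w != z -> A w)). Qed.

(** Serves to patch local extensions across singularities and to pass to the limit
  at infinity. *)
Lemma accumulation_uniq (f g : C -> C) z : ccont f z -> ccont g z ->
  (forall d : R, 0 < d -> exists2 w, cabs (w - z) < d & f w = g w) -> f z = g z.
Proof.
move=> cf cg fg; apply/eqP; rewrite -subr_eq0 -cabs_eq0 eq_le cabs_ge0 andbT.
apply/ler_addgt0Pr => e e0; rewrite add0r.
have e20 : 0 < e / 2 by lra.
have [d1 d10 H1] := cf _ e20; have [d2 d20 H2] := cg _ e20.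
have [|w wz fw] := fg (Num.min d1 d2); first by rewrite lt_min d10.
have zw : z + (w - z) = w by ring.
have := H1 (w - z); have := H2 (w - z); move: wz; rewrite lt_min zw => /andP[-> ->].
move=> /(_ isT) h2 /(_ isT) h1.
have -> : f z - g z = (g w - g z) - (f w - f z) by rewrite fw; ring.
rewrite (le_trans (cabsB _ _)) //; lra.
Qed.

Lemma punctured_uniq (f g : C -> C) z d : 0 < d -> ccont f z -> ccont g z ->
  (forall w, cabs (w - z) < d -> w != z -> f w = g w) -> f z = g z.
Proof.
move=> d0 cf cg fg; apply: accumulation_uniq => // k k0.
pose e := Num.min d k / 2; have m0 : 0 < Num.min d k by rewrite lt_min d0.
have [e0 em] : 0 < e /\ e < Num.min d k by rewrite /e; split; lra.
move: em; rewrite lt_min => /andP[ed ek].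
have zE : z + rc e - z = rc e by ring.
have eE : cabs (rc e : C) = e by rewrite cabs_rc gtr0_norm.
exists (z + rc e); first by rewrite zE eE.
by apply: fg; [rewrite zE eE|rewrite -subr_eq0 zE -cabs_gt0 eE].
Qed.

Lemma derivableE (f : C -> C) z : derivable f z 1 <-> exists l, is_derive z (1 : C) f l.
Proof. by split=> [/derivableP|[l []] //]; exists ('D_1 f z). Qed.

Lemma derivable_ccont (f : C -> C) z : derivable f z 1 -> ccont f z.
Proof. by move=> /derivableE[l /cderiv_cont]. Qed.

Lemma derivable_compC (f g : C -> C) z : derivable g z 1 -> derivable f (g z) 1 ->
  derivable (fun w => f (g w)) z 1.
Proof.
move=> /derivableE[m dm] /derivableE[l dl]; apply/derivableE; exists (m * l).
exact: cderiv_comp.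
Qed.

Lemma derivable_hornerC (p : {poly C}) (z : C) : derivable (horner p : C -> C) z 1.
Proof. by apply/derivableE; exists p^`().[z]; exact: is_derive_hornerC. Qed.

Lemma derivable_invC (w : C) : w != 0 -> derivable (fun u : C => u^-1) w 1.
Proof. by move=> w0; apply/derivable1_diffP; exact: differentiable_Rinv. Qed.

Lemma horner_growth (q : {poly C}) : exists N, poly_growth (horner q) N.
Proof.
elim/poly_ind: q => [|q c [N [A H]]].
  by exists 0%N, 0 => z; rewrite horner0 cabs0 mul0r.
exists N.+1, (A + cabs c) => z; rewrite !hornerE (le_trans (cabsD _ _)) // cabsM.
have z0 := cabs_ge0 z; have c0 := cabs_ge0 c.
have g0 : 1 <= (1 + cabs z) ^+ N by rewrite exprn_ege1 // lerDl.
have := H z; have := cabs_ge0 q.[z]; rewrite exprS; set g := (1 + cabs z) ^+ N in g0 *.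
set x := cabs q.[z] => x0 xg.
have e1 : x * cabs z <= A * g * (1 + cabs z).
  by apply: (@le_trans _ _ (x * (1 + cabs z))); [rewrite ler_wpM2l //; lra|rewrite ler_wpM2r //; lra].
have e2 : cabs c <= cabs c * ((1 + cabs z) * g) by rewrite ler_peMr //; nra.
have -> : (A + cabs c) * ((1 + cabs z) * g) = A * g * (1 + cabs z) + cabs c * ((1 + cabs z) * g) by ring.
exact: lerD.
Qed.

(** Near z, the product f q coincides outside z with a function that is
  differentiable at z as well. *)
Definition clears (f : CP1 -> C) (q : {poly C}) (z : C) := exists2 h : C -> C,
  (\forall w \near z, derivable h w 1) & (\forall w \near z^', f (Some w) * q.[w] = h w).

(** The power of X - a that removes the pole at a clears f at all the points of a
  disc around a, since f is differentiable at the other ones. Multiples of it do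
  so too, which is needed to combine discs. *)
Lemma meromorphic_finite (f : CP1 -> C) (a : C) : meromorphic_at f (Some a) ->
  exists2 q : {poly C}, q != 0 &
  \forall z \near a, forall s, clears f (q * s) z.
Proof.
move=> [k [h [/nbhsCP[d1 d10 H1] /dnbhsCP[d2 d20 H2]]]].
exists (('X - a%:P) ^+ k); first by rewrite expf_neq0 // polyXsubC_eq0.
apply: (proj2 (nbhsCP _ _)); exists (Num.min d1 d2); first by rewrite lt_min d10.
move=> z; rewrite lt_min => /andP[z1 z2] s.
have near_ball (d : R) (A : set C) : cabs (z - a) < d -> (forall w, cabs (w - a) < d -> A w) -> nbhs z A.
  move=> zd dA; apply/nbhsCP; exists (d - cabs (z - a)); first by lra.
  move=> w wz; apply: dA; have := cabsD (w - z) (z - a).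
  have -> : w - z + (z - a) = w - a by ring.
  lra.
exists (fun w => h (w - a) * s.[w]).
  apply: (near_ball d1 _ z1) => w wd; apply: derivableM; last exact: derivable_hornerC.
  apply: (derivable_compC (g := fun w : C => w - a)); last by apply: H1; rewrite subr0.
  by apply: derivableB; [exact: derivable_id|exact: derivable_cst].
have P w : cabs (w - a) < d2 -> w != a -> f (Some w) * (('X - a%:P) ^+ k * s).[w] = h (w - a) * s.[w].
  move=> wd wa; have := H2 (w - a); rewrite subr0 subr_eq0 => /(_ wd wa) /=.
  have -> : a + (w - a) = w by ring.
  move=> ->; rewrite hornerM horner_exp hornerXsubC mulrA [_ * (_ ^+ k)]mulrAC.
  by rewrite mulVf ?mul1r // expf_neq0 // subr_eq0.
have [->|za] := eqVneq z a.
  by apply: (proj2 (dnbhsCP _ _)); exists d2.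
apply: (proj2 (dnbhsCP _ _)).
have za0 : 0 < cabs (z - a) by rewrite cabs_gt0 subr_eq0.
exists (Num.min (d2 - cabs (z - a)) (cabs (z - a))).
  by rewrite lt_min za0 andbT; lra.
move=> w; rewrite lt_min => /andP[w1 w2] _; apply: P.
  have := cabsD (w - z) (z - a); have -> : w - z + (z - a) = w - a by ring.
  lra.
by apply: contraTneq w2 => ->; rewrite cabsBC -leNgt.
Qed.

Lemma meromorphic_infty (f : CP1 -> C) : meromorphic_at f None ->
  exists (r : R) (k : nat) (h : C -> C) (B : R),
    [/\ 0 < r, forall w, r < cabs w -> f (Some w) = w ^+ k * h w^-1,
     forall w, r < cabs w -> derivable (fun u : C => h u^-1) w 1 &
     forall w, r < cabs w -> cabs (h w^-1) <= B].
Proof.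
move=> [k [h [/nbhsCP[d1 d10 H1] /dnbhsCP[d2 d20 H2]]]].
have d0 : derivable h 0 1 by apply: H1; rewrite subrr cabs0.
have [d3 d30 H3] := derivable_ccont d0 ltr01.
pose d := Num.min d1 (Num.min d2 d3).
have dp : 0 < d by rewrite !lt_min d10 d20.
have big w : d^-1 < cabs w -> w != 0 /\ cabs w^-1 < d.
  move=> wd; have w0 : 0 < cabs w by apply: lt_trans wd; rewrite invr_gt0.
  by split; [rewrite -cabs_gt0|rewrite cabsV invf_plt].
exists d^-1, k, h, (cabs (h 0) + 1); split; first by rewrite invr_gt0.
- move=> w /big[w0]; rewrite !lt_min => /and3P[_ wd _].
  have := H2 w^-1; rewrite subr0 invr_eq0 => /(_ wd w0) /=.
  by rewrite invr_eq0 (negbTE w0) invrK => ->; rewrite exprVn invrK.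
- move=> w /big[w0]; rewrite !lt_min => /and3P[wd _ _].
  apply: (derivable_compC (g := fun w : C => w^-1)); last by apply: H1; rewrite subr0.
  exact: derivable_invC.
- move=> w /big[w0]; rewrite !lt_min => /and3P[_ _ wd].
  have := H3 _ wd; rewrite add0r; have := cabsD (h w^-1 - h 0) (h 0).
  by rewrite subrK; lra.
Qed.

(** Compactness of the sphere, as near-covering along the filter of nonzero
  polynomials ordered by divisibility: a property that holds near each point for
  all multiples of some polynomial holds everywhere for some polynomial. *)
Lemma meromorphic_clears (f : CP1 -> C) : (forall p, meromorphic_at f p) ->
  exists2 q : {poly C}, q != 0 & forall z, clears f q z.
Proof.
move=> mf.
pose F : set_system {poly C} := filter_from [set q | q != 0]
  (fun q => [set q' | q' != 0 /\ exists s, q' = q * s]).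
have FF : ProperFilter F.
  apply: filter_from_proper; last by move=> q q0; exists q; split=> //; exists 1; rewrite mulr1.
  apply: filter_from_filter; first by exists 1; exact: oner_neq0.
  move=> p q p0 q0; exists (p * q); first by rewrite /= mulf_neq0.
  move=> u [u0 [s uE]]; split; split=> //.
  - by exists (q * s); rewrite mulrA.
  - by exists (p * s); rewrite mulrCA mulrA.
pose P (q : {poly C}) (x : CP1) := if x is Some z then clears f q z else True.
have /compact_near_coveringP := @one_point_compactification_compact C.
move=> /(_ _ F P _) [].
  case=> [a|] _.
    have [q q0 H] := meromorphic_finite (mf (Some a)).
    exists (Some @` [set z | forall s, clears f (q * s) z], [set q' | q' != 0 /\ exists s, q' = q * s]).
      split; first exact: one_point_compactification_some_nbhs.
      by exists q.
    by move=> [_ _] [/= [z Hz <-] [_ [s ->]]]; exact: Hz.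
  have [r [k [h [B [r0 fh dh _]]]]] := meromorphic_infty (mf None).
  exists ([set x | if x is Some z then r < cabs z else True], [set q' | q' != 0 /\ exists s, q' = 1 * s]).
    split; first exact: (nbhs_infty (r := r)).
    by exists 1 => //; exact: oner_neq0.
  move=> [[z|] q] [/= zr _] //.
  have nz : \forall w \near z, r < cabs w.
    apply: (proj2 (nbhsCP _ _)); exists (cabs z - r); first by lra.
    move=> w wz; have := cabsB w (w - z); have -> : w - (w - z) = z by ring.
    lra.
  exists (fun w => w ^+ k * h w^-1 * q.[w]).
    apply: filterS nz => w wr; apply: derivableM; last exact: derivable_hornerC.
    by apply: derivableM; [exact: exprn_derivable|exact: dh].
  by apply: (@filterS _ (nbhs z) _ _ _ _ nz) => w wr _; rewrite fh.
move=> q q0 H.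
by exists q => // z; apply: (H q _ (Some z) I); split=> //; exists 1; rewrite mulr1.
Qed.

(** The local extensions of f q patch to an entire function F, since two of them
  agree wherever both are defined ([punctured_uniq]). F has polynomial growth:
  it is w^k h(1/w) q(w) near infinity, with h bounded, and it is bounded on
  discs. *)
Lemma meromorphic_rational (f : CP1 -> C) : (forall p, meromorphic_at f p) ->
  exists (p q : {poly C}) (V : set C), [/\ q != 0, open V, dense V &
    forall z, V z -> f (Some z) * q.[z] = p.[z]].
Proof.
move=> mf; have [q q0 cq] := meromorphic_clears mf.
have /choice[H HH] : forall z, exists h : C -> C,
    (\forall w \near z, derivable h w 1) /\ (\forall w \near z^', f (Some w) * q.[w] = h w).
  by move=> z; have [h h1 h2] := cq z; exists h.
pose F z := H z z.
have loc z : exists2 d : R, 0 < d & forall w, cabs (w - z) < d ->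
    [/\ derivable (H z) w 1, F w = H z w & w != z -> f (Some w) * q.[w] = F w].
  have [/nbhsCP[d1 d10 H1] /dnbhsCP[d2 d20 H2]] := HH z.
  exists (Num.min d1 d2); first by rewrite lt_min d10.
  move=> w; rewrite lt_min => /andP[w1 w2].
  have E : F w = H z w.
    have [->//|wz] := eqVneq w z.
    have wz0 : 0 < cabs (w - z) by rewrite cabs_gt0 subr_eq0.
    have [/nbhs_singleton/derivable_ccont cw /dnbhsCP[d3 d30 H3]] := HH w.
    apply: (@punctured_uniq (H w) (H z) w (Num.min d3 (Num.min (d2 - cabs (w - z)) (cabs (w - z))))) => //.
    - by rewrite !lt_min d30 wz0 andbT; lra.
    - by apply: derivable_ccont; exact: H1.
    move=> u; rewrite !lt_min => /and3P[u3 u2 u1] uw.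
    rewrite -H3 // H2 //.
      have := cabsD (u - w) (w - z); have -> : u - w + (w - z) = u - z by ring.
      lra.
    by apply: contraTneq u1 => ->; rewrite cabsBC -leNgt.
  split=> //; first exact: H1.
  by move=> wz; rewrite E; apply: H2.
have dF z : derivable F z 1.
  have [d d0 Hd] := loc z.
  apply: (@near_eq_derivable _ _ _ (H z)); last first.
    by have [|dh _ _ //] := Hd z; rewrite subrr cabs0.
  by apply: (proj2 (nbhsCP _ _)); exists d => // w /Hd[_ -> _].
have /choice[F' dF'] : forall z, exists l, is_derive z (1 : C) F l.
  by move=> z; apply/derivableE.
have [r [k [h [B [r0 fh dh hB]]]]] := meromorphic_infty (mf None).
have Fbig w : r < cabs w -> F w = w ^+ k * h w^-1 * q.[w].
  move=> wr; have [d d0 Hd] := loc w.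
  apply: (@punctured_uniq F (fun w => w ^+ k * h w^-1 * q.[w]) w (Num.min d (cabs w - r))).
  - by rewrite lt_min d0; lra.
  - exact: derivable_ccont.
  - apply: derivable_ccont; apply: derivableM; last exact: derivable_hornerC.
    by apply: derivableM; [exact: exprn_derivable|exact: dh].
  move=> u; rewrite lt_min => /andP[u1 u2] uw.
  have [_ _ <- //] := Hd u u1; rewrite fh //.
  have := cabsB u (u - w); have -> : u - (u - w) = w by ring.
  lra.
have [N [A qA]] := horner_growth q.
have [M FM] : exists M, forall w, cabs w <= r -> cabs (F w) <= M.
  have cF : continuous (@cabs R \o F).
    move=> z; apply: continuous_comp; last exact: cabs_continuous.
    by apply/ccontP; exact: derivable_ccont.
  have := continuous_compact (continuous_subspaceT cF) (compact_disc (r := r)).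
  move=> /compact_bounded[M [_ HM]]; exists (M + 1) => w wr.
  have := HM (M + 1); rewrite ltrDl ltr01 => /(_ isT (cabs (F w))) /=.
  by rewrite ger0_norm ?cabs_ge0 //; apply; exists w.
have A0 : 0 <= A.
  by have := le_trans (cabs_ge0 _) (qA 0); rewrite cabs0 addr0 expr1n mulr1.
have M0 : 0 <= M.
  by apply: le_trans (FM 0 _); rewrite ?cabs_ge0 // cabs0 ltW.
have B0 : 0 <= B.
  apply: le_trans (hB (rc (r + 1)) _); rewrite ?cabs_ge0 // cabs_rc gtr0_norm; lra.
have gF : poly_growth F (k + N).
  exists (M + B * A) => w; have w0 := cabs_ge0 w.
  have g1 n : 1 <= (1 + cabs w) ^+ n by rewrite exprn_ege1 // lerDl.
  have [wr|wr] := leP (cabs w) r.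
    apply: le_trans (FM w wr) _; rewrite -[leLHS]mulr1 ler_pM //.
    by rewrite lerDl mulr_ge0.
  rewrite Fbig // !cabsM cabsX exprD.
  apply: (@le_trans _ _ (((1 + cabs w) ^+ k * B) * (A * (1 + cabs w) ^+ N))).
    rewrite ler_pM ?mulr_ge0 ?exprn_ge0 ?cabs_ge0 //.
    rewrite ler_pM ?exprn_ge0 ?cabs_ge0 ?hB // lerXn2r ?nnegrE //; lra.
  rewrite [X in X <= _](_ : _ = B * A * ((1 + cabs w) ^+ k * (1 + cabs w) ^+ N)); last by ring.
  by rewrite ler_wpM2r ?mulr_ge0 ?exprn_ge0 ?lerDr //; lra.
have [p Fp] := liouville dF' gF.
exists p, q, (interior [set z | f (Some z) * q.[z] = p.[z]]); split=> //.
- exact: open_interior.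
- move=> O [z Oz] oO; have [d d0 Hd] := loc z.
  have /nbhsCP[e e0 He] : nbhs z O by apply: open_nbhs_nbhs.
  pose m := Num.min d e / 2.
  have m0 : 0 < Num.min d e by rewrite lt_min d0.
  have [k0 km] : 0 < m /\ m < Num.min d e by rewrite /m; split; lra.
  move: km; rewrite lt_min => /andP[kd ke].
  have zE : z + rc m - z = rc m by ring.
  have mE : cabs (rc m : C) = m by rewrite cabs_rc gtr0_norm.
  exists (z + rc m); split; first by apply: He; rewrite zE mE.
  apply: (proj2 (nbhsCP _ _)); exists (Num.min m (d - m)); first by rewrite lt_min k0; lra.
  move=> w; rewrite lt_min => /andP[w1 w2] /=; rewrite -Fp.
  have [|_ _] := Hd w; last apply.
    have := cabsD (w - (z + rc m)) (rc m); have -> : w - (z + rc m) + rc m = w - z by ring.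
    rewrite mE; lra.
  apply: contraTneq w1 => ->; rewrite -leNgt cabsBC zE mE //.
- by move=> z /interior_subset.
Qed.

End Meromorphic.

(** * Lagrangian subspaces *)

Section Lagrangian.
Variables (C : numClosedFieldType) (n : nat).
Local Notation m := (n + n)%N.

Definition sympJ : 'M[C]_m := block_mx 0 1%:M (- 1%:M) 0.
Local Notation J := sympJ.

Lemma trJ : J^T = - J.
Proof. by rewrite /sympJ tr_block_mx !trmx0 trmx1 linearN /= trmx1 opp_block_mx !oppr0 opprK. Qed.

Lemma JJ : J *m J = - 1%:M.
Proof.
rewrite /sympJ mulmx_block !(mulmx0, mul0mx, mulmx1, mul1mx, add0r, addr0).
by rewrite (scalar_mx_block n n (1 : C)) opp_block_mx oppr0.
Qed.

Lemma J_unit : J \in unitmx.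
Proof. by have /mulmx1_unit[] : J *m (- J) = 1%:M by rewrite mulmxN JJ opprK. Qed.

Lemma conjJ : map_mx Num.conj J = J.
Proof. by rewrite /sympJ map_block_mx !map_mx0 map_mxN !map_mx1. Qed.

(** A subspace is the row space of B, as for [lagrangian]. *)
Definition isotropic k (B : 'M[C]_(k, m)) := B *m J *m B^T = 0.

Lemma isotropicM k l (A : 'M[C]_(l, k)) (B : 'M[C]_(k, m)) :
  isotropic B -> isotropic (A *m B).
Proof.
move=> H; rewrite /isotropic trmx_mul !mulmxA -(mulmxA A) -(mulmxA A (B *m J)) H.
by rewrite mulmx0 mul0mx.
Qed.

Lemma isotropicS k l (A : 'M[C]_(l, m)) (B : 'M[C]_(k, m)) :
  (A <= B)%MS -> isotropic B -> isotropic A.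
Proof. by move=> /submxP[D ->]; exact: isotropicM. Qed.

(** An isotropic subspace lies in its own symplectic orthogonal, whose dimension is
  2 n minus its own. *)
Lemma isotropic_rank k (B : 'M[C]_(k, m)) : isotropic B -> (\rank B <= n)%N.
Proof.
move=> H; have /mxrankS : (B <= kermx (J *m B^T))%MS by apply/sub_kermxP; rewrite mulmxA.
have -> : \rank (kermx (J *m B^T)) = (m - \rank B)%N.
  by rewrite mxrank_ker eqmxMfull ?mxrank_tr // row_full_unit J_unit.
by have := rank_leq_col B; lia.
Qed.

Lemma isotropic_row (v : 'rV[C]_m) : isotropic v.
Proof.
rewrite /isotropic; set x := _ *m _ *m _.
have xT : x^T = - x by rewrite /x !trmx_mul trmxK trJ mulNmx mulmxN mulmxA.
apply/matrixP => i j; rewrite !ord1 !mxE; have /matrixP/(_ 0 0) := xT.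
rewrite !mxE => /eqP; rewrite -subr_eq0 opprK -mulr2n mulrn_eq0 /=.
by move=> /eqP.
Qed.

(** As long as the rank is less than n, the symplectic orthogonal is strictly
  larger, and any vector of it outside the subspace can be added. *)
Lemma isotropic_extend k (B : 'M[C]_(k, m)) : isotropic B ->
  exists W : 'M[C]_m, [/\ (B <= W)%MS, isotropic W & \rank W = n].
Proof.
have [d] := ubnP (n - \rank B); elim: d k B => // d IH k B dB iB.
have rB := isotropic_rank iB.
have [rn|rn] := eqVneq (\rank B) n.
  exists <<B>>%MS; split; rewrite ?genmxE //.
  by apply: isotropicS iB; rewrite genmxE.
(* A vector v of the symplectic orthogonal of B that is not in B. *)
have /row_subPn[i Hi] : ~~ (kermx (J *m B^T) <= B)%MS.
  apply/negP => /mxrankS; rewrite mxrank_ker.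
  have -> : \rank (J *m B^T) = \rank B.
    by rewrite eqmxMfull ?mxrank_tr // row_full_unit J_unit.
  lia.
set v := row i _ in Hi.
have vB : v *m J *m B^T = 0.
  by rewrite -mulmxA; apply/sub_kermxP; exact: row_sub.
have Bv : B *m J *m v^T = 0.
  apply: trmx_inj; rewrite !trmx_mul trmxK trJ trmx0 mulNmx mulmxN mulmxA vB oppr0 //.
have [W [BW iW rW]] : exists W : 'M[C]_m, [/\ (col_mx B v <= W)%MS, isotropic W & \rank W = n].
  apply: IH; last first.
    rewrite /isotropic tr_col_mx mul_col_mx mul_col_row iB Bv vB.
    by rewrite -[v *m J *m v^T]/(_ *m _) isotropic_row block_mx0.
  have lt : (\rank B < \rank (col_mx B v))%N.
    apply: rank_ltmx; rewrite ltmxE [X in ~~ X]col_mx_sub submx_refl /= Hi andbT.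
    by have := submx_refl (col_mx B v); rewrite col_mx_sub => /andP[].
  lia.
by exists W; split=> //; move: BW; rewrite col_mx_sub => /andP[].
Qed.

(** The matrix form of [lagrangian]. The linear algebra and the factorization only
  need an algebraically closed field with a conjugation. *)
Definition lagrangianmx (W : 'M[C]_m) := \rank W = n /\ isotropic W.

Definition ortho_proj (W : 'M[C]_m) : 'M[C]_m := (proj_ortho W)^T.

(** J times the conjugate of a subspace: for a Lagrangian subspace this is its
  hermitian orthogonal complement. *)
Lemma isotropic_conj k (B : 'M[C]_(k, m)) : isotropic B ->
  isotropic (map_mx Num.conj B *m J).
Proof.
move=> H; rewrite /isotropic trmx_mul trJ mulNmx mulmxN !mulmxA.
rewrite -(mulmxA _ J J) JJ mulmxN mulmx1 !mulNmx opprK -conjJ map_trmx -!map_mxM H.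
exact: map_mx0.
Qed.

(** The complement has rank n and contains the isotropic space of
  [isotropic_conj], of the same rank. *)
Lemma lagrangian_ortho (W : 'M[C]_m) : lagrangianmx W -> lagrangianmx (W^!)%MS.
Proof.
move=> [rW iW]; split.
  by rewrite rank_ortho rW addnK.
apply: isotropicS (isotropic_conj iW).
have sub : (map_mx Num.conj W *m J <= W^!)%MS.
  apply/orthomx1P; rewrite -conjJ -!map_mxM iW; exact: map_mx0.
rewrite -mxrank_leqif_sup // rank_ortho.
by rewrite mxrankMfree ?row_free_unit ?J_unit // mxrank_map rW addnK.
Qed.

(** The columns of A span an isotropic subspace. W is the orthogonal complement of
  a Lagrangian subspace containing it. *)
Lemma lagrangian_kill (A : 'M[C]_m) : A^T *m J *m A = 0 ->
  exists W : 'M[C]_m, lagrangianmx W /\ ortho_proj W *m A = 0.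
Proof.
move=> HA; have [|W [AW iW rW]] := @isotropic_extend _ A^T.
  by rewrite /isotropic trmxK.
exists (W^!)%MS; split; first by exact: lagrangian_ortho.
by rewrite /ortho_proj -[A]trmxK -trmx_mul proj_ortho_0 ?trmx0 // ortho_id.
Qed.

Section Projections.
Variable W : 'M[C]_m.
Hypothesis lW : lagrangianmx W.
Local Notation P := (ortho_proj W).
Local Notation Q := (ortho_proj (W^!)%MS).

Lemma ortho_projD : P + Q = 1%:M.
Proof.
have := add_proj_ortho W (1%:M : 'M[C]_m); rewrite !mul1mx => H.
by rewrite /ortho_proj -linearD /= H trmx1.
Qed.

(** For p the projection, the rows of p and of 1 - p are orthogonal, that is,
  p (1 - p)^* = 0; hence p = p p^* is hermitian. *)
Lemma ortho_proj_conj : map_mx Num.conj P^T = P.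
Proof.
set p := proj_ortho W; set q := proj_ortho (W^!)%MS.
(* Images of the two complementary projections are orthogonal. *)
have pq : p *m (map_mx Num.conj q^T) = 0.
  apply/orthomx1P; rewrite -[p]mul1mx -[q]mul1mx; apply: orthomx_proj_mx_ortho.
  by rewrite ortho_id.
have qE : q = 1%:M - p.
  by have := add_proj_ortho W (1%:M : 'M[C]_m); rewrite !mul1mx => <-; rewrite addrAC subrr add0r.
have pE : p = p *m map_mx Num.conj p^T.
  apply/eqP; rewrite -subr_eq0 -{1}[p]mulmx1 -mulmxBr; apply/eqP.
  have E : (1%:M - p)^T = 1%:M - p^T by rewrite linearB /= trmx1.
  by rewrite -[RHS]pq qE E map_mxB map_mx1.
have cc (A : 'M[C]_m) : map_mx Num.conj (map_mx Num.conj A) = A.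
  by apply/matrixP => i j; rewrite !mxE conjCK.
rewrite /ortho_proj -/p trmxK; clearbody p; rewrite [in LHS]pE map_mxM cc [in RHS]pE.
rewrite trmx_mul; congr (_ *m _).
by apply/matrixP => i j; rewrite !mxE.
Qed.

Lemma ortho_proj_id : P *m P = P.
Proof. by rewrite /ortho_proj -trmx_mul proj_ortho_proj. Qed.

Lemma ortho_proj_ortho : P *m Q = 0 /\ Q *m P = 0.
Proof.
have -> : Q = 1%:M - P by rewrite -ortho_projD addrAC subrr add0r.
by rewrite mulmxBr mulmxBl mulmx1 mul1mx ortho_proj_id subrr.
Qed.

Lemma ortho_proj_isotropic : P^T *m J *m P = 0.
Proof.
have [_ iW] := lW.
rewrite /ortho_proj trmxK; apply: isotropicS iW.
by rewrite proj_orthoE.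
Qed.

End Projections.
End Lagrangian.

(** * Loops presented by polynomials *)

Section Presentations.
Variables (C : numClosedFieldType) (n : nat).
Local Notation J := (sympJ C n).
Local Notation m := (n + n)%N.
Local Notation pconj := (map_poly (Num.conj : C -> C)).
Local Notation Jp := (map_mx polyC J).
Local Notation ev z := (map_mx (horner_eval (z : C))).
Implicit Types (P : 'M[{poly C}]_m) (q r : {poly C}) (a b z : C).

(** The polynomial matrix whose value at z is the conjugate transpose of the
  value of P at the conjugate of z. *)
Definition pstar P : 'M[{poly C}]_m := map_mx pconj P^T.

Lemma pstarM P Q : pstar (P *m Q) = pstar Q *m pstar P.
Proof. by rewrite /pstar trmx_mul map_mxM. Qed.

Lemma trZ q P : (q *: P)^T = q *: P^T.
Proof. by apply/matrixP => i j; rewrite !mxE. Qed.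

Lemma trD P Q : (P + Q)^T = P^T + Q^T.
Proof. by apply/matrixP => i j; rewrite !mxE. Qed.

Lemma pstarD P Q : pstar (P + Q) = pstar P + pstar Q.
Proof. by rewrite /pstar trD map_mxD. Qed.

Lemma pstarZ q P : pstar (q *: P) = pconj q *: pstar P.
Proof. by rewrite /pstar trZ map_mxZ. Qed.

Lemma pconjE q z : (pconj q).[z] = (q.[z^*])^*.
Proof. by rewrite -horner_map /= conjCK. Qed.

Lemma pconjXsubC a : pconj ('X - a%:P) = 'X - (a^*)%:P.
Proof. exact: map_polyXsubC. Qed.

Lemma ev_pstar P z : ev z (pstar P) = map_mx Num.conj (ev z^* P)^T.
Proof. by apply/matrixP => i j; rewrite !mxE /horner_eval pconjE. Qed.

Lemma ev_J z : ev z Jp = J.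
Proof. by apply/matrixP => i j; rewrite !mxE /horner_eval hornerC. Qed.

Lemma evZ q P z : ev z (q *: P) = q.[z] *: ev z P.
Proof. by rewrite map_mxZ. Qed.

Lemma ev0_div P b : ev b P = 0 -> exists D, P = ('X - b%:P) *: D.
Proof.
move=> H; exists (\matrix_(i, j) (P i j %/ ('X - b%:P))).
apply/matrixP => i j; rewrite !mxE mulrC divpK // dvdp_XsubCl.
by apply/rootP; have /matrixP/(_ i j) := H; rewrite !mxE.
Qed.

Lemma mx_scale_inj q P Q : q != 0 -> q *: P = q *: Q -> P = Q.
Proof.
move=> q0 /matrixP H; apply/matrixP => i j; have := H i j; rewrite !mxE.
exact: mulfI.
Qed.

(** A one-sided inverse up to a scalar is two-sided, by multiplying with the
  adjugate. *)
Lemma mul_scalarC P Q q : q != 0 -> P *m Q = q%:M -> Q *m P = q%:M.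
Proof.
move=> q0 PQ.
have dP : \det P != 0.
  have : \det P * \det Q != 0 by rewrite -det_mulmx PQ det_scalar expf_neq0.
  by rewrite mulf_eq0 negb_or => /andP[].
apply: (mx_scale_inj dP); rewrite -!mul_scalar_mx -!mul_adj_mx -!mulmxA; congr (_ *m _).
by rewrite mulmxA PQ scalar_mxC.
Qed.

Hypothesis n_gt0 : (0 < n)%N.

Lemma J_entry : exists i j, Jp i j = 1.
Proof.
exists (lshift n (Ordinal n_gt0)), (rshift n (Ordinal n_gt0)).
by rewrite mxE block_mxEur mxE eqxx.
Qed.

Lemma scale_entry q P i j : (q *: P) i j = q * P i j. Proof. by rewrite mxE. Qed.

(** The identity P^T J P = r J can be divided by a scalar: J has an entry equal
  to 1, which recovers the quotient. *)
Lemma scaleJ_cancel p q P : p != 0 -> p *: P = q *: Jp ->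
  exists2 s, P = s *: Jp & p * s = q.
Proof.
move=> p0 H; have [i [j E]] := J_entry.
have pE : p * P i j = q by have /matrixP/(_ i j) := H; rewrite !scale_entry E mulr1.
exists (P i j) => //; apply: (mx_scale_inj p0); by rewrite scalerA pE.
Qed.

(** The conditions on the loop P / q: conformal symplectic with factor r / q^2,
  unitary on the real line, and equal to the identity at infinity. *)
Definition presents P q r := [/\ q != 0, r != 0, P^T *m Jp *m P = r *: Jp,
  pstar P *m P = (q * pconj q)%:M &
  forall i j, (size (P i j - q *+ (i == j))%R < size q)%N].

Lemma presents_size P q r i j : presents P q r -> (size (P i j) <= size q)%N.
Proof.
move=> [_ _ _ _ sP]; rewrite -(subrK (q *+ (i == j)) (P i j)).
rewrite (leq_trans (size_polyD _ _)) // geq_max (ltnW (sP i j)) /=.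
by case: eqP => _; rewrite ?mulr1n ?mulr0n ?size_poly0.
Qed.

Lemma presents_div P q r b P1 q1 : presents P q r ->
  P = ('X - b%:P) *: P1 -> q = ('X - b%:P) * q1 -> exists r1, presents P1 q1 r1.
Proof.
move=> [q0 r0 PJ PP sP] PE qE.
have b0 : 'X - b%:P != 0 :> {poly C} by rewrite polyXsubC_eq0.
have [r1 PJ1 r1E] : exists2 r1, P1^T *m Jp *m P1 = r1 *: Jp & ('X - b%:P) ^+ 2 * r1 = r.
  apply: scaleJ_cancel; first by rewrite expf_neq0.
  by rewrite -PJ PE trZ -!scalemxAl -scalemxAr scalerA expr2.
have q10 : q1 != 0 by apply: contra_neq q0 => q10; rewrite qE q10 mulr0.
exists r1; split=> //.
- by apply: contra_neq r0 => r10; rewrite -r1E r10 mulr0.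
- apply: (@mx_scale_inj (('X - b%:P) * pconj ('X - b%:P))).
    by rewrite mulf_neq0 // map_poly_eq0.
  move: PP; rewrite PE qE pstarZ -scalemxAl -scalemxAr scalerA mulrC => ->.
  by rewrite scale_scalar_mx [pconj (_ * q1)]rmorphM /= mulrACA.
- move=> i j; have := sP i j; rewrite PE qE mxE -mulrnAr -mulrBr.
  rewrite [X in (_ < X)%N]size_mul // size_XsubC /=.
  have [->|p0] := eqVneq (P1 i j - q1 *+ (i == j)) 0.
    by rewrite size_poly0 size_poly_gt0.
  by rewrite size_mul // size_XsubC.
Qed.

(** The simple element p_{a,W} is this matrix divided by X - a^*. *)
Definition simple_num a (W : 'M[C]_m) : 'M[{poly C}]_m :=
  ('X - a%:P) *: map_mx polyC (ortho_proj W) +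
  ('X - (a^*)%:P) *: map_mx polyC (ortho_proj (W^!)%MS).

Section SimpleNum.
Variables (a : C) (W : 'M[C]_m).
Hypothesis lW : lagrangianmx W.
Let lW' := lagrangian_ortho lW.
Local Notation pi := (map_mx polyC (ortho_proj W)).
Local Notation pi' := (map_mx polyC (ortho_proj (W^!)%MS)).

Lemma pstar_simple_num : pstar (simple_num a W) = simple_num a^* W.
Proof.
have E (V : 'M[C]_m) : pstar (map_mx polyC (ortho_proj V)) = map_mx polyC (ortho_proj V).
  rewrite -{2}(ortho_proj_conj V); apply/matrixP => i j; rewrite !mxE.
  by rewrite map_polyC.
rewrite /simple_num; by rewrite pstarD !pstarZ !pconjXsubC conjCK !E.
Qed.

Lemma simple_num_conjM : simple_num a^* W *m simple_num a W = (('X - a%:P) * ('X - (a^*)%:P))%:M.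
Proof.
have [pq qp] := ortho_proj_ortho W.
rewrite /simple_num conjCK mulmxDl !mulmxDr -!scalemxAl -!scalemxAr -!map_mxM.
have -> : ortho_proj W^!%MS *m ortho_proj W^!%MS = ortho_proj (W^!)%MS := ortho_proj_id _.
rewrite pq qp ortho_proj_id !map_mx0 !scaler0 addr0 add0r !scalerA.
rewrite [X in X *: _ + _]mulrC -scalerDr -map_mxD ortho_projD.
by rewrite map_scalar_mx /= polyC1 scalemx1.
Qed.

Lemma sandwich_scale (p q : {poly C}) (A K B : 'M[{poly C}]_m) :
  (p *: A) *m K *m (q *: B) = (p * q) *: (A *m K *m B).
Proof. by rewrite -scalemxAr -!scalemxAl scalerA mulrC. Qed.

(** The terms containing the same projection twice vanish because W and its
  complement are isotropic. *)
Lemma simple_num_symplectic :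
  (simple_num a W)^T *m Jp *m simple_num a W = (('X - a%:P) * ('X - (a^*)%:P)) *: Jp.
Proof.
have mapE (A B : 'M[C]_m) : (map_mx polyC A)^T *m Jp *m map_mx polyC B =
    map_mx polyC (A^T *m J *m B) by rewrite !map_mxM map_trmx.
have i1 := ortho_proj_isotropic lW; have i2 := ortho_proj_isotropic lW'.
have E : (ortho_proj W)^T *m J *m ortho_proj (W^!)%MS + (ortho_proj (W^!)%MS)^T *m J *m ortho_proj W = J.
  have : (1%:M : 'M[C]_m)^T *m J *m 1%:M = J by rewrite trmx1 mul1mx mulmx1.
  rewrite -(ortho_projD W) [(_ + _)^T]linearD /= !(mulmxDl, mulmxDr) i1 i2.
  by rewrite add0r addr0 addrC.
rewrite /simple_num trD !trZ; move: ('X - a%:P) ('X - (a^*)%:P) => x y.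
rewrite !(mulmxDl, mulmxDr) !sandwich_scale !mapE i1 i2 map_mx0 !scaler0 add0r addr0.
by rewrite [y * x]mulrC -scalerDr -map_mxD addrC E.
Qed.

Lemma simple_numE : simple_num a W = ('X - (a^*)%:P)%:M + (a^* - a)%:P *: pi.
Proof.
have -> : ('X - (a^*)%:P)%:M = ('X - (a^*)%:P) *: (pi + pi').
  by rewrite -map_mxD ortho_projD map_scalar_mx /= polyC1 scalemx1.
rewrite scalerDr addrAC -scalerDl /simple_num; congr (_ *: _ + _).
by rewrite polyCB addrA subrK.
Qed.

End SimpleNum.

(** Dividing P / q on the left by p_{a,W}, whose inverse is p_{a^*,W}. The factor
  X - a in the denominator of p_{a^*,W} cancels because pi_W kills P(a). *)
Lemma presents_quotient a W P q r : lagrangianmx W -> presents P q (('X - a%:P) * r) ->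
  ortho_proj W *m ev a P = 0 ->
  exists2 P1, simple_num a W *m P1 = ('X - (a^*)%:P) *: P & presents P1 q (('X - (a^*)%:P) * r).
Proof.
move=> lW pr piP; have [q0 r0 PJ PP sP] := pr.
have a0 : 'X - a%:P != 0 :> {poly C} by rewrite polyXsubC_eq0.
have a0' : 'X - (a^*)%:P != 0 :> {poly C} by rewrite polyXsubC_eq0.
have [P1 P1E] : exists P1, simple_num a^* W *m P = ('X - a%:P) *: P1.
  apply: ev0_div; rewrite map_mxM simple_numE conjCK map_mxD.
  have -> : ev a ('X - a%:P)%:M = 0 :> 'M[C]_m.
    by rewrite map_scalar_mx /= /horner_eval hornerXsubC subrr; apply/matrixP => i j; rewrite !mxE mul0rn.
  rewrite add0r evZ -scalemxAl.
  have -> : ev a (map_mx polyC (ortho_proj W)) = ortho_proj W.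
    by apply/matrixP => i j; rewrite !mxE /horner_eval hornerC.
  by rewrite piP scaler0.
exists P1.
  apply: (mx_scale_inj a0); rewrite scalemxAr -P1E mulmxA.
  have := simple_num_conjM a^* W; rewrite conjCK => ->.
  by rewrite mul_scalar_mx mulrC scalerA.
split=> //.
- by move: r0; rewrite !mulf_eq0 !negb_or => /andP[_ ->]; rewrite a0'.
- apply: (@mx_scale_inj (('X - a%:P) ^+ 2)); first by rewrite expf_neq0.
  have -> : ('X - a%:P) ^+ 2 *: (P1^T *m Jp *m P1) =
     (('X - a%:P) *: P1)^T *m Jp *m (('X - a%:P) *: P1).
    by rewrite trZ -!scalemxAl -scalemxAr scalerA expr2.
  rewrite -P1E.
  have -> : (simple_num a^* W *m P)^T *m Jp *m (simple_num a^* W *m P) =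
      P^T *m ((simple_num a^* W)^T *m Jp *m simple_num a^* W) *m P by rewrite trmx_mul !mulmxA.
  rewrite simple_num_symplectic // conjCK -scalemxAr -scalemxAl PJ !scalerA.
  by congr (_ *: _); ring.
- apply: (@mx_scale_inj (('X - (a^*)%:P) * ('X - a%:P))); first by rewrite mulf_neq0.
  have -> : (('X - (a^*)%:P) * ('X - a%:P)) *: (pstar P1 *m P1) =
     pstar (('X - a%:P) *: P1) *m (('X - a%:P) *: P1).
    by rewrite pstarZ pconjXsubC -!scalemxAl -scalemxAr scalerA.
  rewrite -P1E pstarM pstar_simple_num // conjCK.
  have -> : pstar P *m simple_num a W *m (simple_num a^* W *m P) = pstar P *m (simple_num a W *m simple_num a^* W) *m P.
    by rewrite !mulmxA.
  have := simple_num_conjM a^* W; rewrite conjCK => ->.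
  by rewrite mul_mx_scalar -scalemxAl PP.
- move=> i j.
  have [->|p0] := eqVneq (P1 i j - q *+ (i == j)) 0; first by rewrite size_poly0 size_poly_gt0.
  have E : ('X - a%:P) * (P1 i j - q *+ (i == j)) = ('X - a%:P) * (P i j - q *+ (i == j)) +
      (a - a^*)%:P * (map_mx polyC (ortho_proj W) *m P) i j.
    rewrite mulrBr -scale_entry -P1E simple_numE conjCK mulmxDl mul_scalar_mx -scalemxAl.
    by rewrite mxE !scale_entry mulrBr addrAC.
  have : (size (('X - a%:P) * (P1 i j - q *+ (i == j)))%R <= size q)%N.
    rewrite E (leq_trans (size_polyD _ _)) // geq_max; apply/andP; split.
      have [->|d0] := eqVneq (P i j - q *+ (i == j)) 0; first by rewrite mulr0 size_poly0.
      by rewrite size_mul // size_XsubC; exact: sP.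
    rewrite mul_polyC (leq_trans (size_scale_leq _ _)) // mxE.
    apply: leq_trans (size_sum _ _ _) _; apply/bigmax_leqP => k _; rewrite mxE mul_polyC (leq_trans (size_scale_leq _ _)) //.
    exact: presents_size pr.
  by rewrite size_mul // size_XsubC.
Qed.

(** The two cases in which the root b of q can be cancelled: P(b)^* P(b) = 0 for
  b real, and otherwise r P^* = - q q^* J P^T J evaluated at the conjugate of b. *)
Lemma presents_root0 b P q r : presents P q r -> root q b ->
  (b \is Num.real) || ~~ root r b^* -> ev b P = 0.
Proof.
move=> [q0 r0 PJ PP sP] /rootP qb /orP[/CrealP bR|rb].
  have H : map_mx Num.conj (ev b P)^T *m ev b P = 0.
    rewrite -{1}bR -ev_pstar -map_mxM PP map_scalar_mx /= /horner_eval hornerM qb mul0r.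
    by apply/matrixP => i j; rewrite !mxE mul0rn.
  apply/matrixP => i j; rewrite [RHS]mxE; set A := ev b P in H *.
  have : (map_mx Num.conj A^T *m A) j j = 0 by rewrite H mxE.
  rewrite mxE => /eqP; rewrite psumr_eq0; last first.
    by move=> k _; rewrite !mxE mulrC mul_conjC_ge0.
  by move=> /allP/(_ i (mem_index_enum _)); rewrite !mxE mulrC mul_conjC_eq0 => /eqP.
have qq : q * pconj q != 0 by rewrite mulf_neq0 // map_poly_eq0.
have PPs := mul_scalarC qq PP.
have H : (q * pconj q) *: (P^T *m Jp) = r *: (Jp *m pstar P).
  have := congr1 (fun A => A *m pstar P) PJ.
  by rewrite /= -mulmxA PPs mul_mx_scalar -scalemxAl.
have : ev b^* ((q * pconj q) *: (P^T *m Jp)) = ev b^* (r *: (Jp *m pstar P)) by rewrite H.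
rewrite !evZ hornerM pconjE conjCK qb conjC0 mulr0 scale0r map_mxM ev_J => /esym/eqP.
rewrite scaler_eq0 (negPf (rb : r.[b^*] != 0)) /= => /eqP E.
have : ev b^* (pstar P) = 0 by rewrite -(mulKmx (J_unit C n) (ev b^* (pstar P))) E mulmx0.
rewrite ev_pstar conjCK => E2; apply/matrixP => i j.
by have /matrixP/(_ j i) := E2; rewrite !mxE => /eqP; rewrite conjC_eq0 => /eqP.
Qed.

(** The factorization, stated as an induction principle: a presented loop is
  reached from constants by multiplying P and q by a common factor and by left
  multiplication with simple elements. The outer induction is on the degree of
  q, the inner one on the multiplicity of b^* as a root of r. *)
Theorem presents_ind (Phi : 'M[{poly C}]_m -> {poly C} -> Prop) :
  (forall c, c != 0 -> Phi (c%:P)%:M c%:P) ->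
  (forall b P q, Phi P q -> Phi (('X - b%:P) *: P) (('X - b%:P) * q)) ->
  (forall a W P q P1, a \isn't Num.real -> lagrangianmx W ->
     simple_num a W *m P1 = ('X - (a^*)%:P) *: P -> Phi P1 q -> Phi P q) ->
  forall P q r, presents P q r -> Phi P q.
Proof.
move=> Phi1 PhiD PhiS P q.
have [N] := ubnP (size q); elim: N P q => // N IH P q qN r pr.
have [q0 r0 PJ PP sP] := pr.
have [q1|q1] := eqVneq (size q) 1%N.
  have /size_poly1P[c c0 qE] := introT eqP q1.
  suff -> : P = (c%:P)%:M by rewrite qE; exact: Phi1.
  apply/matrixP => i j; have := sP i j; rewrite q1 ltnS leqn0 size_poly_eq0 subr_eq0 => /eqP ->.
  by rewrite qE !mxE.
have [b qb] := closed_rootP q q1.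
have div P' r' : presents P' q r' -> (b \is Num.real) || ~~ root r' b^* -> Phi P' q.
  move=> pr' cond; have [D P'E] := ev0_div (presents_root0 pr' qb cond).
  have /factor_theorem[q' qE] := qb.
  have qE' : q = ('X - b%:P) * q' by rewrite mulrC.
  have [r1 pr1] := presents_div pr' P'E qE'.
  rewrite P'E qE'; apply: PhiD; apply: IH pr1.
  have q'0 : q' != 0 by apply: contra_neq q0 => q'0; rewrite qE q'0 mul0r.
  by move: qN; rewrite qE' size_mul ?polyXsubC_eq0 // size_XsubC.
have [bR|bR] := boolP (b \is Num.real); first by apply: div pr _; rewrite bR.
have [k [s sb rE]] := multiplicity_XsubC r b^*.
rewrite r0 /= in sb.
elim: k s sb r rE r0 P pr {PJ PP sP} => [|k IHk] s sb r rE r0 P pr.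
  by apply: div pr _; rewrite rE expr0 mulr1 sb orbT.
have rE' : r = ('X - (b^*)%:P) * (s * ('X - (b^*)%:P) ^+ k) by rewrite rE exprS mulrCA.
have [_ _ PJ _ _] := pr; rewrite rE' in pr.
have /lagrangian_kill[W [lW WP]] : (ev b^* P)^T *m J *m ev b^* P = 0.
  have : ev b^* (P^T *m Jp *m P) = ev b^* (r *: Jp) by rewrite PJ.
  rewrite !map_mxM ev_J evZ map_trmx => ->.
  by rewrite rE' hornerM hornerXsubC subrr mul0r scale0r.
have [P1 P1E pr1] := presents_quotient lW pr WP.
(* One zero of r moves from b^* to b, and b^* <> b. *)
apply: (PhiS b^* W P q P1) => //.
  by apply: contra bR => /CrealP; rewrite conjCK => H; apply/CrealP.
rewrite conjCK in pr1.
apply: (IHk (('X - b%:P) * s)) pr1.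
- rewrite rootM negb_or sb andbT root_XsubC; apply: contra bR => /eqP H.
  by apply/CrealP.
- by rewrite mulrA.
- have [_ + _ _ _] := pr; rewrite mulf_eq0 negb_or => /andP[_ sk].
  by rewrite mulf_neq0 // polyXsubC_eq0.
Qed.

End Presentations.

Section PresentationsValues.
Variables (C : numClosedFieldType) (n : nat).
Local Notation J := (sympJ C n).
Local Notation m := (n + n)%N.
Local Notation pconj := (map_poly (Num.conj : C -> C)).
Local Notation Jp := (map_mx polyC J).
Local Notation ev z := (map_mx (horner_eval (z : C))).
Implicit Types (P : 'M[{poly C}]_m) (q r : {poly C}) (a b z : C).
Hypothesis n_gt0 : (0 < n)%N.

Lemma presents_one : presents (1%:M : 'M[{poly C}]_m) 1 1.
Proof.
split; rewrite ?oner_eq0 //.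
- by rewrite trmx1 mul1mx mulmx1 scale1r.
- by rewrite mulmx1 /pstar trmx1 map_mx1 mul1r [pconj 1]rmorph1.
- by move=> i j; rewrite mxE subrr size_poly0 size_poly1.
Qed.

(** For the degrees, P P' - q q' = (P - q) P' + q (P' - q'). *)
Lemma presents_mul P q r P' q' r' : presents P q r -> presents P' q' r' ->
  presents (P *m P') (q * q') (r * r').
Proof.
move=> pr pr'; have [q0 r0 PJ PP sP] := pr; have [q0' r0' PJ' PP' sP'] := pr'.
split; rewrite ?mulf_neq0 //.
- have -> : (P *m P')^T *m Jp *m (P *m P') = P'^T *m (P^T *m Jp *m P) *m P'.
    by rewrite trmx_mul !mulmxA.
  by rewrite PJ -scalemxAr -scalemxAl PJ' scalerA.
- rewrite pstarM mulmxA -(mulmxA _ (pstar P)) PP mul_mx_scalar -scalemxAl PP'.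
  by rewrite scale_scalar_mx [pconj (q * q')]rmorphM /= mulrACA.
move=> i j.
have -> : (P *m P') i j - q * q' *+ (i == j) =
    \sum_k (P i k - q *+ (i == k)) * P' k j + q * (P' i j - q' *+ (i == j)).
  rewrite mxE; under [in RHS]eq_bigr => k _ do rewrite mulrBl.
  have E : \sum_k q *+ (i == k) * P' k j = q * P' i j.
    rewrite (bigD1 i) //= eqxx mulr1n big1 ?addr0 // => k ki.
    by rewrite eq_sym (negPf ki) mulr0n mul0r.
  by rewrite sumrB E mulrBr addrA subrK mulrnAr.
have s0 (p : {poly C}) : p != 0 -> (0 < size p)%N by rewrite size_poly_gt0.
rewrite size_mul //; have q1 := s0 _ q0; have q1' := s0 _ q0'.
apply: leq_ltn_trans (size_polyD _ _) _; rewrite gtn_max; apply/andP; split.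
  apply: leq_ltn_trans (size_sum _ _ _) _.
  have -> : (size q + size q').-1 = (size q + size q').-2.+1 by lia.
  rewrite ltnS; apply/bigmax_leqP => k _; apply: leq_trans (size_polyMleq _ _) _.
  have := sP i k; have := presents_size k j pr'; lia.
apply: leq_ltn_trans (size_polyMleq _ _) _; move: (sP' i j) q1 q1'.
by move: (size (P' i j - _)) (size q) (size q') => x y z; lia.
Qed.

Lemma pstarK P : pstar (pstar P) = P.
Proof.
apply/matrixP => i j; rewrite !mxE; apply/polyP => k.
by rewrite !coef_map /= conjCK.
Qed.

(** By reality this presents the inverse loop. Its conformal identity is
  P J P^T = r J conjugated, which holds because J P^T J is an inverse of P up to
  the scalar - r. *)
Lemma presents_star P q r : presents P q r -> presents (pstar P) (pconj q) (pconj r).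
Proof.
move=> [q0 r0 PJ PP sP].
have qq : q * pconj q != 0 by rewrite mulf_neq0 // map_poly_eq0.
split; rewrite ?map_poly_eq0 //.
- have JpJp : Jp *m Jp = - 1%:M by rewrite -map_mxM JJ map_mxN map_mx1.
  have : (- (Jp *m P^T *m Jp)) *m P = r%:M.
    by rewrite mulNmx -!mulmxA (mulmxA P^T) PJ -scalemxAr JpJp scalerN opprK scalemx1.
  move=> /(mul_scalarC r0); rewrite mulmxN => H.
  have PJP : P *m Jp *m P^T = r *: Jp.
    have -> : P *m Jp *m P^T = - (P *m (Jp *m P^T *m Jp)) *m Jp.
      by rewrite -[LHS]mulmx1 -[1%:M]opprK -JpJp mulmxN mulNmx !mulmxA.
    by rewrite H mul_scalar_mx.
  have -> : (pstar P)^T = map_mx pconj P by rewrite /pstar -map_trmx trmxK.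
  have E : map_mx pconj Jp = Jp.
    rewrite -[in RHS](conjJ C n) -!map_mx_comp.
    by apply: eq_map_mx => x; exact: map_polyC.
  by rewrite -{1}E -!map_mxM PJP map_mxZ E.
- rewrite pstarK (mul_scalarC qq PP); congr (_%:M); rewrite mulrC; congr (_ * _).
  by apply/polyP => k; rewrite !coef_map /= conjCK.
- move=> i j; have := sP j i; rewrite !mxE.
  have -> : pconj (P j i) - pconj q *+ (i == j) = pconj (P j i - q *+ (j == i)).
    by rewrite rmorphB rmorphMn eq_sym.
  by rewrite !size_map_poly.
Qed.

Lemma presents_simple a (W : 'M[C]_m) : lagrangianmx W ->
  presents (simple_num a W) ('X - (a^*)%:P) (('X - a%:P) * ('X - (a^*)%:P)).
Proof.
move=> lW; split.
- by rewrite polyXsubC_eq0.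
- by rewrite mulf_neq0 // polyXsubC_eq0.
- exact: simple_num_symplectic.
- by rewrite pstar_simple_num // simple_num_conjM pconjXsubC conjCK mulrC.
- move=> i j; rewrite size_XsubC simple_numE !mxE addrAC subrr add0r -polyCM.
  by rewrite (leq_ltn_trans (size_polyC_leq1 _)).
Qed.

Definition ratval P q z : 'M[C]_m := q.[z]^-1 *: ev z P.

Lemma ratval_entry P q z i j : ratval P q z i j = (P i j).[z] / q.[z].
Proof. by rewrite !mxE mulrC. Qed.

Lemma ratvalM P q P' q' z : ratval (P *m P') (q * q') z = ratval P q z *m ratval P' q' z.
Proof. by rewrite /ratval map_mxM hornerM invfM -scalemxAl -scalemxAr scalerA. Qed.

Lemma ratvalZ P q s z : s.[z] != 0 -> ratval (s *: P) (s * q) z = ratval P q z.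
Proof. by move=> s0; rewrite /ratval evZ hornerM invfM scalerA mulrAC mulVf ?mul1r. Qed.

Lemma ratval_conj P q z : map_mx Num.conj (ratval P q z^*)^T = ratval (pstar P) (pconj q) z.
Proof.
apply/matrixP => i j; rewrite !mxE !rmorphM /= fmorphV /=.
by rewrite /horner_eval !pconjE.
Qed.

Lemma ratval_simple a (W : 'M[C]_m) z : z != a^* ->
  ratval (simple_num a W) ('X - (a^*)%:P) z = ((z - a) / (z - a^*)) *: ortho_proj W + ortho_proj (W^!)%MS.
Proof.
move=> za; have z0 : z - a^* != 0 by rewrite subr_eq0.
rewrite /simple_num; move: (ortho_proj W) (ortho_proj _) => A B.
by apply/matrixP => i j; rewrite !mxE /horner_eval !hornerE; field.
Qed.

Lemma ratval_star P q r z : presents P q r -> (q * pconj q).[z] != 0 ->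
  ratval (pstar P) (pconj q) z *m ratval P q z = 1%:M.
Proof.
move=> [_ _ _ PP _] qz; rewrite -ratvalM PP /ratval map_scalar_mx /= /horner_eval.
by rewrite [pconj q * q]mulrC scale_scalar_mx mulVf.
Qed.

Lemma ratval_symplectic P q r z : presents P q r ->
  (ratval P q z)^T *m J *m ratval P q z = (q.[z]^-1 * (q.[z]^-1 * r.[z])) *: J.
Proof.
move=> [_ _ PJ _ _]; rewrite /ratval [(_ *: _)^T]linearZ /= -!scalemxAl -scalemxAr scalerA.
have -> : (ev z P)^T *m J *m ev z P = ev z (P^T *m Jp *m P).
  by rewrite !map_mxM ev_J map_trmx.
by rewrite PJ evZ ev_J scalerA -mulrA.
Qed.

(** The converse of [ratval_symplectic] and [ratval_star]: identities between
  values on a set S on which polynomials are determined are identities between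
  polynomials. The factor r is read off at an entry of J equal to 1. *)
Lemma presents_from_values P q (S : C -> Prop) :
  (forall p : {poly C}, (forall z, S z -> p.[z] = 0) -> p = 0) ->
  (forall z, S z -> [/\ q.[z] != 0, (pconj q).[z] != 0,
     exists2 c, c != 0 & (ratval P q z)^T *m J *m ratval P q z = c *: J &
     ratval (pstar P) (pconj q) z *m ratval P q z = 1%:M]) ->
  (forall i j, (size (P i j - q *+ (i == j))%R < size q)%N) ->
  exists r, presents P q r.
Proof.
move=> Sd HS sP.
have Smx (A : 'M[{poly C}]_m) : (forall z, S z -> ev z A = 0) -> A = 0.
  move=> H; apply/matrixP => i j; rewrite mxE; apply: Sd => z /H /matrixP/(_ i j).
  by rewrite !mxE.
have [i0 [j0 E]] := J_entry C n_gt0.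
have E' : J i0 j0 = 1 by move: E; rewrite mxE => /polyC_inj.
pose K := P^T *m Jp *m P; pose r := K i0 j0.
have Kz z : S z -> exists2 c, c != 0 & ev z K = c *: J.
  move=> /HS[q0 _ [c c0 H] _]; exists (q.[z] ^+ 2 * c); first by rewrite mulf_neq0 // expf_neq0.
  rewrite -scalerA -H /ratval [(_ *: _)^T]linearZ /= -!scalemxAl -scalemxAr !scalerA.
  rewrite !map_mxM ev_J map_trmx -[LHS]scale1r; congr (_ *: _).
  by field.
have rz z c : ev z K = c *: J -> r.[z] = c.
  by move=> /matrixP/(_ i0 j0); rewrite [LHS]mxE [RHS]mxE E' mulr1.
have S0 : exists z, S z.
  apply: contrapT => /forallNP H; have := Sd 1 (fun z Sz => False_ind _ (H z Sz)).
  by move/eqP; rewrite oner_eq0.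
have [z0 Sz0] := S0.
exists r; split=> //.
- by have [q0 _ _ _] := HS _ Sz0; apply: contra_neq q0 => ->; rewrite horner0.
- by have [c c0 H] := Kz _ Sz0; apply: contra_neq c0 => r0; rewrite -(rz _ _ H) r0 horner0.
- apply/eqP; rewrite -subr_eq0; apply/eqP; apply: Smx => z Sz.
  have [c c0 H] := Kz _ Sz.
  by rewrite map_mxB evZ ev_J (rz _ _ H) -/K H subrr.
- apply/eqP; rewrite -subr_eq0; apply/eqP; apply: Smx => z Sz.
  have [q0 qc _ H] := HS _ Sz.
  rewrite map_mxB; apply/eqP; rewrite subr_eq0; apply/eqP.
  move: H; rewrite -ratvalM /ratval => /(congr1 (fun A => (pconj q * q).[z] *: A)).
  rewrite scalerA mulfV ?hornerM ?mulf_neq0 // scale1r => ->.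
  by rewrite scalemx1 map_scalar_mx /= /horner_eval hornerM mulrC.
Qed.

End PresentationsValues.

(** * Open dense sets and equality of loops *)

Section DenseOpen.
Variable R : realType.
Local Notation C := (Cplx R).
Local Notation CP1 := (one_point_compactification C).

Definition open_dense {T : topologicalType} (U : set T) := open U /\ dense U.

Lemma open_denseI {T : topologicalType} (U V : set T) :
  open_dense U -> open_dense V -> open_dense (U `&` V).
Proof. by move=> [oU dU] [oV dV]; split; [exact: openI|exact: denseI]. Qed.

Lemma open_denseT {T : topologicalType} : open_dense [set: T].
Proof. by split; [exact: openT|move=> O O0 _; rewrite setIT]. Qed.

Lemma open_dense_bigI {T : topologicalType} (I : finType) (V : I -> set T) :
  (forall i, open_dense (V i)) -> open_dense [set x | forall i, V i x].
Proof.
move=> H; have K (s : seq I) : open_dense [set x | forall i, i \in s -> V i x].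
  elim: s => [|i s IH].
    by rewrite (_ : [set x | _] = setT); [exact: open_denseT|apply/seteqP; split].
  rewrite (_ : [set x | _] = V i `&` [set x | forall i, i \in s -> V i x]).
    exact: open_denseI.
  apply/seteqP; split=> x /= => [xs|[xi xs] j].
    by split=> [|j js]; apply: xs; rewrite inE ?eqxx // js orbT.
  by rewrite inE => /orP[/eqP ->|/xs].
rewrite (_ : [set x | _] = [set x | forall i, i \in enum I -> V i x]) //.
by apply/seteqP; split=> x /= xs i => [_|]; apply: xs; rewrite ?mem_enum.
Qed.

Lemma openCP (V : set C) : open V <->
  forall z, V z -> exists2 d : R, 0 < d & forall w, cabs (w - z) < d -> V w.
Proof.
rewrite openE; split=> H z.
  by move=> /H /nbhsCP.
by move=> /H Hz; apply: (proj2 (nbhsCP _ _)).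
Qed.

Lemma denseCP (V : set C) : dense V <->
  forall z (d : R), 0 < d -> exists2 w, cabs (w - z) < d & V w.
Proof.
split=> [dV z d d0|H O [z Oz] /openCP/(_ z Oz)[d d0 dO]].
  have [|| w [wz Vw]] := dV [set w | cabs (w - z) < d].
  - by exists z; rewrite /= subrr cabs0.
  - apply/openCP => w /= wz; exists (d - cabs (w - z)); first by lra.
    move=> u uw; have := cabsD (u - w) (w - z).
    have -> : u - w + (w - z) = u - z by ring.
    lra.
  - by exists w.
by have [w wz Vw] := H z d d0; exists w; split=> //; exact: dO.
Qed.

Lemma open_dense_preimage (U : set CP1) : open_dense U ->
  open_dense [set z | U (Some z)].
Proof.
move=> [oU dU]; split.
  rewrite openE => z Uz; have : nbhs (Some z : CP1) U by exact: open_nbhs_nbhs.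
  exact: one_point_compactification_some_continuous.
move=> O [z Oz] oO; have [||x [[w Ow <-] Uw]] := dU (Some @` O).
- by exists (Some z); exists z.
- exact: one_point_compactification_open_some.
- by exists w.
Qed.

(** A nonempty open set of the sphere contains a finite point: a neighbourhood of
  infinity is the complement of a compact subset of the plane, which is bounded. *)
Lemma open_dense_image (V : set C) : open_dense V -> open_dense (Some @` V : set CP1).
Proof.
move=> [oV dV]; split; first exact: one_point_compactification_open_some.
move=> O [x Ox] oO.
suff [z Oz] : exists z, O (Some z).
  have [||w [Ow Vw]] := dV [set z | O (Some z)].
  - by exists z.
  - rewrite openE => w Ow; have : nbhs (Some w : CP1) O by exact: open_nbhs_nbhs.
    exact: one_point_compactification_some_continuous.
  - by exists (Some w); split=> //; exists w.
case: x Ox => [z|] Ox; first by exists z.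
have [K [cK _] KO] : nbhs (None : CP1) O by exact: open_nbhs_nbhs.
suff [z Kz] : exists z, ~ K z by exists z; apply: KO; left; exists z.
apply: contrapT => /forallNP H.
have := continuous_compact (continuous_subspaceT (@cabs_continuous R)) cK.
move=> /compact_bounded[M [_ HM]].
have M0 := normr_ge0 M; have MM : M < `|M| + 1 by have := ler_norm M; lra.
have r0 : 0 <= `|M| + 2 by lra.
have rK : (@cabs R @` K) (`|M| + 2).
  exists (rc (`|M| + 2)); last by rewrite cabs_rc ger0_norm.
  by apply: contrapT; exact: H.
by have := HM _ MM _ rK; rewrite /= ger0_norm // lerD2l leNgt ltr1n.
Qed.

(** Equality of loops only involves the finite points. *)
Lemma loop_eqCP m (g h : CP1 -> 'M[C]_m) : loop_eq g h <->
  exists2 V : set C, open_dense V & forall z, V z -> g (Some z) = h (Some z).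
Proof.
split=> [[U [oU dU UE]]|[V odV VE]].
  by exists [set z | U (Some z)]; [exact: open_dense_preimage|move=> z /UE].
have [oV dV] := open_dense_image odV; exists (Some @` V); split=> //.
by move=> _ [z Vz <-]; exact: VE.
Qed.

Lemma loop_eq_sym m (g h : CP1 -> 'M[C]_m) : loop_eq g h -> loop_eq h g.
Proof. by move=> [U [oU dU UE]]; exists U; split=> // p /UE. Qed.

Lemma loop_eq_trans m (g h k : CP1 -> 'M[C]_m) :
  loop_eq g h -> loop_eq h k -> loop_eq g k.
Proof.
move=> /loop_eqCP[V oV VE] /loop_eqCP[W oW WE]; apply/loop_eqCP.
by exists (V `&` W); [exact: open_denseI|move=> z [/VE -> /WE]].
Qed.

Lemma open_dense_conj (V : set C) : open_dense V -> open_dense [set z | V z^*].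
Proof.
move=> [/openCP oV /denseCP dV]; split.
  apply/openCP => z /= /oV[d d0 H]; exists d => // w wz; apply: H.
  by rewrite -rmorphB cabs_conj.
apply/denseCP => z d d0; have [w wz Vw] := dV z^* d d0.
exists w^*; last by rewrite /= conjCK.
by rewrite -[z]conjCK -rmorphB cabs_conj.
Qed.

(** A nonzero polynomial has too few roots to vanish on a disc. *)
Lemma poly_nonvanishing (q : {poly C}) (z : C) (d : R) : q != 0 -> 0 < d ->
  exists2 w, cabs (w - z) < d & q.[w] != 0.
Proof.
move=> q0 d0; apply: contrapT => /forall2NP H.
pose s := [seq z + rc (d / k.+2%:R) | k <- iota 0 (size q)].
have us : uniq s.
  rewrite map_inj_uniq ?iota_uniq // => i j /addrI /complexI /mulfI.
  by rewrite gt_eqF // => /(_ isT) /invr_inj /eqP; rewrite eqr_nat => /eqP[].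
have rs : all (root q) s.
  apply/allP => _ /mapP[k _ ->]; have [] := H (z + rc (d / k.+2%:R)).
    move=> []; have -> : z + rc (d / k.+2%:R) - z = rc (d / k.+2%:R) by ring.
    rewrite cabs_rc gtr0_norm ?divr_gt0 // ltr_pdivrMr //.
    by rewrite -[X in X < _]mulr1 ltr_pM2l // ltr1n.
  by move=> /negP; rewrite negbK.
by have := max_poly_roots q0 rs us; rewrite size_map size_iota ltnn.
Qed.

Lemma open_dense_nonroot (q : {poly C}) : q != 0 -> open_dense [set z | q.[z] != 0].
Proof.
move=> q0; split; last by apply/denseCP => z d d0; exact: poly_nonvanishing.
apply/openCP => z qz; have qz0 : 0 < cabs q.[z] / 2 by rewrite divr_gt0 // cabs_gt0.
have [d d0 Hd] := derivable_ccont (@derivable_hornerC R q z) qz0.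
exists d => // w /Hd; have -> : z + (w - z) = w by ring.
move=> H; rewrite /= -cabs_gt0; have := cabsB q.[w] (q.[w] - q.[z]).
have -> : q.[w] - (q.[w] - q.[z]) = q.[z] by ring.
have q1 : 0 < cabs q.[z] by rewrite cabs_gt0.
lra.
Qed.

Lemma open_dense_poly0 (V : set C) (p : {poly C}) : open_dense V ->
  (forall z, V z -> p.[z] = 0) -> p = 0.
Proof.
move=> oV H; apply/eqP; apply: contrapT => /negP p0.
have [_ /denseCP/(_ 0 1 ltr01)[z _ [Vz]]] := open_denseI oV (open_dense_nonroot p0).
by rewrite /= H // eqxx.
Qed.

End DenseOpen.

(** * Presented loops belong to the group *)

Section Reversal.
Variable C : numClosedFieldType.
Implicit Types (p : {poly C}) (z : C) (d : nat).

(** X^d p(1/X), the expression of p in the coordinate at infinity. *)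
Definition revp d p : {poly C} := \poly_(k < d.+1) p`_(d - k).

Lemma revpE d p z : (size p <= d.+1)%N -> z != 0 -> p.[z^-1] = (revp d p).[z] / z ^+ d.
Proof.
move=> sp z0; rewrite (horner_coef_wide _ sp) horner_poly mulr_suml.
rewrite (reindex_inj rev_ord_inj) /=; apply: eq_bigr => k _.
rewrite subSS -mulrA; congr (_ * _).
have kd : (k <= d)%N by rewrite -ltnS.
have -> : z ^+ d = z ^+ (d - k) * z ^+ k by rewrite -exprD subnK.
by rewrite invfM mulrCA mulfV ?expf_neq0 // mulr1 exprVn.
Qed.

Lemma revp0 d p : (revp d p).[0] = p`_d.
Proof. by rewrite horner_coef0 coef_poly subn0. Qed.
End Reversal.

Section ToLminus.
Variables (R : realType) (n : nat).
Local Notation C := (Cplx R).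
Local Notation CP1 := (one_point_compactification C).
Local Notation m := (n + n)%N.
Local Notation pconj := (map_poly (Num.conj : C -> C)).
Implicit Types (P : 'M[{poly C}]_m) (q r : {poly C}).
Hypothesis n_gt0 : (0 < n)%N.

Lemma J_sympJ : J R n = sympJ C n. Proof. by []. Qed.

(** The form of conformality used in [CSp], tested on the vectors of the standard
  basis. *)
Lemma omega_mx (A : 'M[C]_m) (c : C) :
  (forall v w, omega (A *m v) (A *m w) = c * omega v w) <->
  A^T *m sympJ C n *m A = c *: sympJ C n.
Proof.
split=> H.
  apply/matrixP => i j; rewrite [RHS]mxE.
  have := H (delta_mx i 0) (delta_mx j 0); rewrite /omega trmx_mul J_sympJ.
  have E (B : 'M[C]_m) : ((delta_mx i 0 : 'cV[C]_m)^T *m B *m delta_mx j (0 : 'I_1)) 0 0 = B i j.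
    by rewrite trmx_delta -rowE -colE !mxE.
  by rewrite !mulmxA -(mulmxA _ A^T) -(mulmxA _ (A^T *m _)) !E.
move=> v w; rewrite /omega J_sympJ trmx_mul !mulmxA -(mulmxA _ A^T) -(mulmxA _ (A^T *m _)) H.
by rewrite -scalemxAr -scalemxAl mxE.
Qed.

Definition ratloop P q : CP1 -> 'M[C]_m := fun p => if p is Some z then ratval P q z else 1%:M.

Lemma ratio_derivable (p s : {poly C}) (a z : C) : s.[a + z] != 0 ->
  derivable (fun w : C => p.[a + w] / s.[a + w]) z 1.
Proof.
move=> sz; have dA : derivable (fun w : C => a + w) z 1.
  by apply: derivableD; [exact: derivable_cst|exact: derivable_id].
apply: derivableM; first exact: derivable_compC dA (@derivable_hornerC R p (a + z)).
apply: (derivable_compC (f := fun u : C => u^-1) (g := fun w : C => s.[a + w])).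
  exact: derivable_compC dA (@derivable_hornerC R s (a + z)).
exact: derivable_invC.
Qed.

Lemma ratio_derivable_near (p s : {poly C}) (a : C) : s.[a] != 0 ->
  \forall z \near (0 : C), derivable (fun w : C => p.[a + w] / s.[a + w]) z 1.
Proof.
move=> sa; have s0 : s != 0 by apply: contra_neq sa => ->; rewrite horner0.
have [/openCP/(_ a sa)[d d0 H] _] := open_dense_nonroot s0.
apply: (proj2 (nbhsCP _ _)); exists d => // w; rewrite subr0 => wd.
apply: ratio_derivable; apply: H; by have -> : a + w - a = w by ring.
Qed.

Lemma holomorphic_meromorphic (f : CP1 -> C) p : holomorphic_at f p -> meromorphic_at f p.
Proof.
move=> H; exists 0%N, (f \o chart p); split=> //.
by apply: (proj2 (dnbhsCP _ _)); exists 1 => // w _ _; rewrite expr0 invr1 mul1r.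
Qed.

(** In the coordinate at infinity an entry of P / q is a quotient of reversed
  polynomials. The denominator takes the value lead_coef q at 0, and the degree
  condition says that the numerator takes the value lead_coef q or 0 there. *)
Lemma ratloop_holomorphic_infty P q r i j : presents P q r ->
  holomorphic_at (fun p => ratloop P q p i j) None.
Proof.
move=> pr; have [q0 r0 _ _ sP] := pr; pose d := (size q).-1.
have sq : size q = d.+1 by rewrite prednK // size_poly_gt0.
rewrite /holomorphic_at.
have -> : (fun p => ratloop P q p i j) \o @chart R None =
    fun z : C => (revp d (P i j)).[0 + z] / (revp d q).[0 + z].
  apply/funext => z; rewrite /= add0r; case: eqP => [->|/eqP z0] /=.
    rewrite !revp0 mxE; have qd : q`_d != 0 by rewrite -/(lead_coef q) lead_coef_eq0.
    have : (P i j - q *+ (i == j))`_d = 0 by apply/leq_sizeP: (leqnn d); have := sP i j; rewrite sq ltnS.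
    by rewrite coefB coefMn => /eqP; rewrite subr_eq0 => /eqP ->; rewrite mulrnAl divff.
  rewrite ratval_entry !(revpE (d := d)) ?sq // -?sq ?(presents_size i j pr) //.
  by rewrite invf_div mulrA divfK ?expf_neq0.
apply: ratio_derivable_near; rewrite revp0 -/(lead_coef q) lead_coef_eq0 //.
Qed.

Lemma ratloop_meromorphic P q r p i j : presents P q r ->
  meromorphic_at (fun p => ratloop P q p i j) p.
Proof.
case: p => [a|] pr; last exact/holomorphic_meromorphic/ratloop_holomorphic_infty/pr.
have [q0 _ _ _ _] := pr.
have [k [s sa qE]] := multiplicity_XsubC q a; rewrite q0 /= in sa.
exists k, (fun w : C => (P i j).[a + w] / s.[a + w]); split; first exact: ratio_derivable_near.
apply: (proj2 (dnbhsCP _ _)); exists 1 => // w _ _.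
rewrite /= ratval_entry qE hornerM horner_exp hornerXsubC addrAC subrr add0r.
by rewrite invfM mulrA mulrC.
Qed.

(** Stated up to equality of loops because [Lminus_tau] is used for
  representatives with arbitrary values outside a dense open set. *)
Lemma presents_Lminus P q r g : presents P q r -> loop_eq g (ratloop P q) ->
  Lminus_tau R n g.
Proof.
move=> pr gE; have [q0 r0 _ _ sP] := pr.
have [V oV VE] := (loop_eqCP _ _).1 gE.
have qq0 : q * pconj q != 0 by rewrite mulf_neq0 // map_poly_eq0.
have oQ := open_dense_nonroot qq0; have oW := open_denseI oV oQ.
split.
- exists (Some @` (V `&` [set z | (q * pconj q).[z] != 0])).
  have [? ?] := open_dense_image oW; split=> //.
    move=> _ [a [Va qa] <-] i j.
    have [/openCP/(_ a (conj Va qa))[d d0 H] _] := oW.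
    apply: (proj2 (nbhsCP _ _)); exists d => // z; rewrite subr0 => zd.
    have HW w : cabs (w - z) < d - cabs z -> (V `&` [set z | (q * pconj q).[z] != 0]) (a + w).
      move=> wz; apply: H; have -> : a + w - a = w - z + z by ring.
      by have := cabsD (w - z) z; lra.
    apply: (@near_eq_derivable _ _ _ (fun w : C => (P i j).[a + w] / q.[a + w])); last first.
      apply: ratio_derivable; have [|_] := HW z; first by rewrite subrr cabs0 subr_gt0.
      by rewrite /= hornerM mulf_eq0 negb_or => /andP[].
    apply: (proj2 (nbhsCP _ _)); exists (d - cabs z); first by rewrite subr_gt0.
    by move=> w /HW[Vw _]; rewrite /= VE //= ratval_entry.
  move=> _ [a [Va qa] <-]; rewrite VE //=; split.
    by have /mulmx1_unit[] := ratval_star pr qa.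
  by exists (q.[a]^-1 * (q.[a]^-1 * r.[a])); apply/omega_mx; exact: ratval_symplectic.
- by exists (ratloop P q); split=> // p i j; exact: ratloop_meromorphic pr.
- by exists (ratloop P q); split=> // i j; exact: ratloop_holomorphic_infty pr.
- apply/loop_eqCP; exists ((V `&` [set z | (q * pconj q).[z] != 0]) `&` [set z | V z^*]).
    by apply: open_denseI => //; exact: open_dense_conj.
  move=> z [[Vz qz] Vz'] /=; rewrite !VE //= /tau map_trmx ratval_conj.
  have H := ratval_star pr qz; have [u _] := mulmx1_unit H.
  by rewrite -[RHS](mulKmx u) H mulmx1.
Qed.

End ToLminus.

(** * Loops of the group are presented *)

Section FromLminus.
Variables (R : realType) (n : nat).
Local Notation C := (Cplx R).
Local Notation CP1 := (one_point_compactification C).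
Local Notation m := (n + n)%N.
Local Notation pconj := (map_poly (Num.conj : C -> C)).
Implicit Types (P : 'M[{poly C}]_m) (q r : {poly C}).
Hypothesis n_gt0 : (0 < n)%N.

Lemma common_denominator (g : CP1 -> 'M[C]_m) : rational_loop g ->
  exists P q (V : set C), [/\ q != 0, open_dense V &
    forall z, V z -> q.[z] != 0 /\ g (Some z) = ratval P q z].
Proof.
move=> [h [/loop_eqCP[V0 oV0 gh] mh]].
have /choice[F HF] : forall ij : 'I_m * 'I_m, exists pqV : {poly C} * {poly C} * set C,
    [/\ pqV.1.2 != 0, open_dense pqV.2 &
    forall z, pqV.2 z -> h (Some z) ij.1 ij.2 * pqV.1.2.[z] = pqV.1.1.[z]].
  move=> [i j]; have [p [q [V [q0 oV dV E]]]] := meromorphic_rational (fun x => mh x i j).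
  by exists (p, q, V).
(* A common denominator is the product of the denominators of the entries. *)
pose q := \prod_ij (F ij).1.2.
pose P : 'M[{poly C}]_m := \matrix_(i, j) ((F (i, j)).1.1 * \prod_(kl | kl != (i, j)) (F kl).1.2).
have q0 : q != 0 by apply/prodf_neq0 => ij _; have [] := HF ij.
exists P, q, ((V0 `&` [set z | forall ij, (F ij).2 z]) `&` [set z | q.[z] != 0]); split=> //.
  apply: open_denseI; last exact: open_dense_nonroot.
  by apply: open_denseI => //; apply: open_dense_bigI => ij; have [] := HF ij.
move=> z [[Vz Hz] qz]; split=> //; rewrite gh //; apply/matrixP => i j.
rewrite ratval_entry mxE; have [_ _ /(_ z (Hz (i, j))) E] := HF (i, j).
have qE : q = (F (i, j)).1.2 * \prod_(kl | kl != (i, j)) (F kl).1.2 by rewrite /q (bigD1 (i, j)).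
move: qz; rewrite /= qE !hornerM mulf_eq0 negb_or => /andP[z1 z2].
by rewrite -E /= -(mulrA (h _ _ _)) mulfK // mulf_neq0.
Qed.

(** Were the degree d of D = P_ij - q delta_ij at least that of q, then
  D / X^d would have a nonzero limit at infinity, whereas it is the product of
  D / q, which tends to 0, and of q / X^d, which is bounded. *)
Lemma degree_from_infinity (g : CP1 -> 'M[C]_m) P q (V : set C) :
  negative_loop g -> q != 0 -> open_dense V ->
  (forall z, V z -> q.[z] != 0 /\ g (Some z) = ratval P q z) ->
  forall i j, (size (P i j - q *+ (i == j))%R < size q)%N.
Proof.
move=> [h [/loop_eqCP[V0 oV0 gh] hh h1]] q0 oV VE i j.
set D := P i j - _; rewrite ltnNge; apply/negP => qD.
pose d := (size D).-1.
have sq : (0 < size q)%N by rewrite size_poly_gt0.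
have sD : size D = d.+1 by rewrite prednK // (leq_trans sq).
have [k [dk k0 kE]] : exists k : C -> C, [/\ derivable k 0 1, k 0 = (i == j)%:R &
    forall u, u != 0 -> k u = h (Some u^-1) i j].
  exists (fun u => h (chart None u) i j); split.
  - by have /nbhs_singleton := hh i j.
  - by rewrite /chart eqxx h1 mxE.
  - by move=> u u0; rewrite /chart (negPf u0).
have : (k 0 - (i == j)%:R) * (revp d q).[0] = (revp d D).[0].
  apply: (@accumulation_uniq R (fun u => (k u - (i == j)%:R) * (revp d q).[u])
    (fun u => (revp d D).[u])).
  - apply: derivable_ccont; apply: derivableM; last exact: derivable_hornerC.
    by apply: derivableB; [exact: dk|exact: derivable_cst].
  - exact/derivable_ccont/derivable_hornerC.
  move=> e e0; have [_ /denseCP dW] := open_denseI oV0 oV.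
  (* A point of the dense set in a disc of radius 1 far away, so that 1 / w is
     within e of 0. *)
  have [w wd [V0w Vw]] := dW (rc (e^-1 + 2)) 1 ltr01.
  have ei : 0 < e^-1 by rewrite invr_gt0.
  have we : e^-1 < cabs w.
    have := cabsB w (w - rc (e^-1 + 2)).
    have -> : w - (w - rc (e^-1 + 2)) = rc (e^-1 + 2) by ring.
    rewrite cabs_rc gtr0_norm; lra.
  have w0 : w != 0 by rewrite -cabs_gt0; lra.
  have [qw gw] := VE w Vw.
  exists w^-1; first by rewrite subr0 cabsV invf_plt // posrE; lra.
  have wi0 : w^-1 != 0 by rewrite invr_eq0.
  have rE (p : {poly C}) : (size p <= d.+1)%N -> (revp d p).[w^-1] = p.[w] * w^-1 ^+ d.
    by move=> sp; have := revpE sp wi0; rewrite invrK => ->; rewrite divfK // expf_neq0.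
  rewrite !rE ?sD // -?sD // mulrA; congr (_ * _).
  rewrite kE // invrK -gh // gw ratval_entry mulrBl divfK //.
  by rewrite /D hornerD hornerN hornerMn mulr_natl.
rewrite k0 subrr mul0r revp0 -/(lead_coef D) => /esym/eqP.
by rewrite lead_coef_eq0 -size_poly_eq0 sD.
Qed.

(** On a common dense open set the loop takes its values in the group, satisfies
  the reality condition and equals P / q. *)
Lemma Lminus_presents (g : CP1 -> 'M[C]_m) : Lminus_tau R n g ->
  exists P q r, presents P q r /\ loop_eq g (ratloop P q).
Proof.
move=> [[U [oU dU _ UG]] rg ng tg].
have [P [q [V [q0 oV VE]]]] := common_denominator rg.
have sP := degree_from_infinity ng q0 oV VE.
have [T oT TE] := (loop_eqCP _ _).1 tg.
have oU' := open_dense_preimage (conj oU dU).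
pose S := [set z | U (Some z)] `&` T `&` (V `&` [set z | V z^*]).
have oS : open_dense S.
  apply: open_denseI; first exact: open_denseI.
  by apply: open_denseI => //; exact: open_dense_conj.
suff [r pr] : exists r, presents P q r.
  exists P, q, r; split=> //; apply/loop_eqCP; exists V => // z Vz.
  by have [] := VE z Vz.
apply: (@presents_from_values C n n_gt0 P q S) => //.
  by move=> p; exact: open_dense_poly0.
move=> z [[Uz Tz] [Vz Vz']]; have [qz gz] := VE z Vz; have [qz' gz'] := VE _ Vz'.
have [gU [c gc]] := UG _ Uz; rewrite gz in gU gc.
split=> //.
- by rewrite pconjE conjC_eq0.
- exists c; last exact/omega_mx.
  have [i [j E]] := J_entry C n_gt0.
  have E' : sympJ C n i j = 1 by move: E; rewrite mxE => /polyC_inj.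
  apply/eqP => c0; move: gc; rewrite c0 => /omega_mx; rewrite scale0r => H.
  have J0 : sympJ C n = 0.
    have gUT : (ratval P q z)^T \in unitmx by rewrite unitmx_tr.
    rewrite -[LHS](mulmxK gU) -[X in X *m _](mulKmx gUT) (mulmxA _ (sympJ C n)) H.
    by rewrite mulmx0 mul0mx.
  by move: E'; rewrite J0 mxE => /esym/eqP; rewrite oner_eq0.
- have := TE z Tz; rewrite /= gz' gz /tau map_trmx ratval_conj => H.
  have [u|u] := boolP (ratval (pstar P) (pconj q) z \in unitmx).
    by rewrite -H mulmxV.
  by move: u; rewrite -H in gU; rewrite unitmx_inv in gU; rewrite gU.
Qed.

Lemma simple_element_ratval a (W : 'M[C]_m) z : z != a^* ->
  simple_element a W (Some z) = ratval (simple_num a W) ('X - (a^*)%:P) z.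
Proof. by move=> za; rewrite ratval_simple. Qed.

Lemma lagrangianE (W : 'M[C]_m) : lagrangian W <-> lagrangianmx W.
Proof.
split=> -[rW iW]; split=> //.
  apply/matrixP => i j; have := iW (row i W)^T (row j W)^T.
  rewrite !trmxK !row_sub => /(_ isT isT); rewrite /omega trmxK J_sympJ => H.
  rewrite [RHS]mxE -[RHS]H tr_row -!row_mul !mxE; apply: eq_bigr => k _; congr (_ * _).
  by rewrite !mxE.
move=> v w /submxP[x vE] /submxP[y wE]; rewrite /omega vE -[w]trmxK wE J_sympJ.
rewrite trmx_mul !mulmxA -(mulmxA x) -(mulmxA x (W *m _)).
by rewrite [W *m _ *m _]iW mulmx0 mul0mx mxE.
Qed.

Lemma simple_element_ratloop a (W : 'M[C]_m) :
  loop_eq (simple_element a W) (ratloop (simple_num a W) ('X - (a^*)%:P)).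
Proof.
apply/loop_eqCP; exists [set z | ('X - (a^*)%:P).[z] != 0].
  by apply: open_dense_nonroot; rewrite polyXsubC_eq0.
move=> z za; rewrite simple_element_ratval //.
by move: za; rewrite /= hornerXsubC subr_eq0.
Qed.

Lemma generated_presents (g : CP1 -> 'M[C]_m) : generated (simple_elements R n) g ->
  exists P q r, presents P q r /\ loop_eq g (ratloop P q).
Proof.
elim=> {g} [g [a [W [_ /lagrangianE lW ->]]]||g h _ [P [q [r [pr gE]]]] _ [P' [q' [r' [pr' hE]]]]
  |g _ [P [q [r [pr gE]]]]|g h gh _ [P [q [r [pr gE]]]]].
- exists (simple_num a W), ('X - (a^*)%:P), (('X - a%:P) * ('X - (a^*)%:P)).
  by split; [exact: presents_simple|exact: simple_element_ratloop].
- exists 1%:M, 1, 1; split; first exact: presents_one.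
  apply/loop_eqCP; exists setT; first exact: open_denseT.
  move=> z _; rewrite /= /ratval map_mx1 hornerC invr1 scale1r //.
- exists (P *m P'), (q * q'), (r * r'); split; first exact: presents_mul.
  have [V oV VE] := (loop_eqCP _ _).1 gE; have [V' oV' VE'] := (loop_eqCP _ _).1 hE.
  apply/loop_eqCP; exists (V `&` V'); first exact: open_denseI.
  by move=> z [Vz Vz']; rewrite /= ratvalM /loop_mul VE // VE'.
- exists (pstar P), (pconj q), (pconj r); split; first exact: presents_star.
  have [V oV VE] := (loop_eqCP _ _).1 gE.
  have qq0 : q * pconj q != 0.
    by have [q0 _ _ _ _] := pr; rewrite mulf_neq0 // map_poly_eq0.
  apply/loop_eqCP; exists (V `&` [set z | (q * pconj q).[z] != 0]).
    by apply: open_denseI => //; exact: open_dense_nonroot.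
  move=> z [Vz qz]; rewrite /= /loop_inv VE //=.
  have H := ratval_star pr qz; have [_ u] := mulmx1_unit H.
  by rewrite -[RHS](mulmxK u) H mul1mx.
- exists P, q, r; split=> //; exact: loop_eq_trans (loop_eq_sym gh) gE.
Qed.

Lemma presents_generated P q r : presents P q r ->
  generated (simple_elements R n) (ratloop P q).
Proof.
move: P q r; apply: (presents_ind n_gt0) => [c c0|b P q IH|a W P q P1 aR lW PE IH].
- apply: generated_eq (generated_one _); apply/loop_eqCP; exists setT; first exact: open_denseT.
  move=> z _; rewrite /= /ratval map_scalar_mx /= /horner_eval hornerC.
  by rewrite scale_scalar_mx mulVf.
- apply: generated_eq IH; apply/loop_eqCP; exists [set z | ('X - b%:P).[z] != 0].
    by apply: open_dense_nonroot; rewrite polyXsubC_eq0.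
  by move=> z zb; rewrite /= ratvalZ.
- have gs : generated (simple_elements R n) (simple_element a W).
    by apply: generated_in; exists a, W; split=> //; apply/lagrangianE.
  apply: generated_eq (generated_mul gs IH).
  apply/loop_eqCP; exists [set z | ('X - (a^*)%:P).[z] != 0].
    by apply: open_dense_nonroot; rewrite polyXsubC_eq0.
  move=> z zb; rewrite /loop_mul simple_element_ratval /= -?ratvalM ?PE ?ratvalZ //.
  by move: zb; rewrite /= hornerXsubC subr_eq0.
Qed.

End FromLminus.

Theorem theorem4p1 (R : realType) (n : nat) :
  generated (simple_elements R n) = Lminus_tau R n.
Proof.
case: (posnP n) => [-> {n}|n_gt0]; last first.
  apply/seteqP; split=> g.
    by move=> /(generated_presents n_gt0)[P [q [r [pr gE]]]]; exact: presents_Lminus pr gE.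
  move=> /(Lminus_presents n_gt0)[P [q [r [pr gE]]]].
  by apply: generated_eq (presents_generated n_gt0 pr); exact: loop_eq_sym.
(* In dimension 0 there is a single matrix, hence a single loop. *)
apply/seteqP; split=> g _; have -> : g = @loop_one R (0 + 0).
1, 3: by apply/funext => p; rewrite [g p]flatmx0 [RHS]flatmx0.
  have oT := @open_denseT (one_point_compactification (Cplx R)).
  have refl : loop_eq (@loop_one R (0 + 0)) (@loop_one R (0 + 0)) by exists setT; case: oT; split.
  split.
  - exists setT; case: oT => oT dT; split=> // [p _ [] //|p _]; split; first exact: unitmx1.
    by exists 1 => v w; rewrite [v]flatmx0 [w]flatmx0 !mulmx0 mul1r.
  - by exists (@loop_one R (0 + 0)); split=> // p [].
  - by exists (@loop_one R (0 + 0)); split=> // -[].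
  - by exists setT; case: oT => oT dT; split=> // p _; rewrite [LHS]flatmx0 [RHS]flatmx0.
exact: generated_one.
Qed.
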